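(* Let $\delta$ be a generic loop parameter and $0\le d\le n$. The dimension of the simple module $V_{(n,d)}$ of $A_{(\mathcal{B},\delta)}(n)$ is $$\dim V_{(n,d)}=\sum_{k=0}^{n}\binom nk\left(\binom{n-k}{(n-k+d)/2}-\binom{n-k}{(n-k+d+2)/2}\right)=:m_{n,d}.$$ In particular, the dimension of $V_{(n,0)}$ is the $n$-th Motzkin number $m_n$.
   Context: By convention a binomial coefficient is $0$ if its bottom entry is not an integer (or exceeds the top entry). The $n$-th Motzkin number $m_n$ is the number of lattice paths in $\mathbb{N}\times\mathbb{N}$ from $(0,0)$ to $(n,0)$ with steps $(1,1),(1,0),(1,-1)$. The algebras: $\mathcal{B}(n,n)$ is the set of noncrossing partitions of $n$ upper points $1,\dots,n$ and $n$ lower points $1',\dots,n'$ (noncrossing with respect to the order $1<\dots<n<n'<\dots<1'$) all of whose blocks have size $1$ or $2$. $A_{(\mathcal{B},\delta)}(n)$ is the complex vector space with basis $e_p$, $p\in\mathcal{B}(n,n)$, and product $e_pe_q=\delta^me_r$, where $p$ is drawn above $q$, the lower points of $p$ are identified with the upper points of $q$, $r$ is the resulting partition of the outer points and $m$ is the number of connected components not connected to any outer point. $\delta>0$ is generic if $A_{(\mathcal{B},\delta)}(n)$ is semisimple for all $n$. Link states: an $n$-link state is a noncrossing partition of $n$ points on a line into pairs and singletons, each singleton being declared either proper or a defect, where a singleton $j$ with $i<j<k$ and $i,k$ paired must be proper. A partition $p\in\mathcal{B}(n,n)$ acts on a link state $v$ by drawing $p$ above $v$, connecting lines (a resulting singleton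 is a defect iff it is connected to a defect of $v$), deleting all components not connected to the upper boundary, and multiplying by $\delta$ for each deleted component without a defect (components with a defect are deleted without scalar). This makes the span of $n$-link states a left $A_{(\mathcal{B},\delta)}(n)$-module. $M_{(n,d)}$ is the submodule spanned by link states with at most $d$ defects, $V_{(n,0)}=M_{(n,0)}$ and $V_{(n,d)}=M_{(n,d)}/M_{(n,d-1)}$ for $1\le d\le n$. *)

(* Defs.v *)
From HB Require Import structures.
From mathcomp Require Import all_boot all_order all_algebra ring_quotient.
From mathcomp Require Import complex.
From mathcomp Require Import reals.

Set Implicit Arguments.
Unset Strict Implicit.
Unset Printing Implicit Defensive.

Import GRing.Theory.
Local Open Scope ring_scope.
Local Open Scope quotient_scope.
Local Open Scope complex_scope.

Section VQuotient.
Variables (K : fieldType) (vT : vectType K) (W : {vspace vT}).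

(* [Quotient.quot] is the library's quotient zmodule; we add the scalars and
   the finite dimension. *)
Definition vquot : Type := Quotient.quot (W : zmodClosed vT).

HB.instance Definition _ := GRing.Zmodule.on vquot.

Definition vquot_pi (v : vT) : vquot := \pi_(Quotient.quot (W : zmodClosed vT)) v.
Definition vquot_repr (x : vquot) : vT :=
  repr (x : Quotient.quot (W : zmodClosed vT)).

Lemma vquot_reprK x : vquot_pi (vquot_repr x) = x.
Proof. exact: reprK. Qed.

Lemma vquot_piE u v : (vquot_pi u == vquot_pi v) = (u - v \in W).
Proof. by rewrite (Quotient.idealrBE (W : zmodClosed vT)). Qed.

Lemma vquot_piD u v : vquot_pi (u + v) = vquot_pi u + vquot_pi v.
Proof. exact: (Quotient.pi_add (W : zmodClosed vT)). Qed.

Lemma vquot_repr_mem v : vquot_repr (vquot_pi v) - v \in W.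
Proof. by rewrite -vquot_piE vquot_reprK. Qed.

Definition vquot_scale (a : K) (x : vquot) : vquot :=
  vquot_pi (a *: vquot_repr x).

Lemma vquot_piZ a v : vquot_pi (a *: v) = vquot_scale a (vquot_pi v).
Proof.
apply/eqP; rewrite vquot_piE -scalerBr rpredZ // -opprB rpredN.
exact: vquot_repr_mem.
Qed.

Fact vquot_scaleA a b x :
  vquot_scale a (vquot_scale b x) = vquot_scale (a * b) x.
Proof. by rewrite -[x]vquot_reprK -!vquot_piZ scalerA. Qed.
Fact vquot_scale1 : left_id 1 vquot_scale.
Proof. by move=> x; rewrite -[x]vquot_reprK -vquot_piZ scale1r. Qed.
Fact vquot_scaleDr : right_distributive vquot_scale +%R.
Proof.
move=> a x y; rewrite -[x]vquot_reprK -[y]vquot_reprK.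
by rewrite -vquot_piD -!vquot_piZ -vquot_piD scalerDr.
Qed.
Fact vquot_scaleDl x : {morph vquot_scale^~ x : a b / a + b}.
Proof.
by move=> a b; rewrite -[x]vquot_reprK -!vquot_piZ -vquot_piD scalerDl.
Qed.

HB.instance Definition _ := GRing.Zmodule_isLmodule.Build K vquot
  vquot_scaleA vquot_scale1 vquot_scaleDr vquot_scaleDl.

Fact vquot_pi_linear : linear vquot_pi.
Proof. by move=> a u v; rewrite vquot_piD vquot_piZ. Qed.
HB.instance Definition _ :=
  GRing.isLinear.Build K vT vquot _ vquot_pi vquot_pi_linear.

Let compl_proj : 'End(vT) := daddv_pi (W^C)%VS W.

Let compl_capv : ((W^C)%VS :&: W = 0)%VS.
Proof. by rewrite capvC capv_compl. Qed.

Let compl_proj_sub v : v - compl_proj v \in W.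
Proof.
have := @daddv_pi_add _ _ (W^C)%VS W v compl_capv.
rewrite addvC addv_complf memvf => /(_ isT) {1}<-.
by rewrite addrC addKr memv_pi.
Qed.

Let compl_proj0 v : v \in W -> compl_proj v = 0.
Proof.
move=> Wv; have := @daddv_pi_add _ _ (W^C)%VS W v compl_capv.
rewrite addvC addv_complf memvf => /(_ isT).
rewrite (daddv_pi_id _ Wv) ?capv_compl // => e.
by apply: (addIr v); rewrite e add0r.
Qed.

Let compl_proj_repr v : compl_proj (vquot_repr (vquot_pi v)) = compl_proj v.
Proof.
by apply/subr0_eq; have := compl_proj0 (vquot_repr_mem v); rewrite linearB.
Qed.

Fact vquot_vect_axiom : Vector.axiom (\dim (W^C)%VS) vquot.
Proof.
exists (fun x => \row_i coord (vbasis (W^C)%VS) i (compl_proj (vquot_repr x))).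
  move=> k x y; apply/rowP=> i; rewrite !mxE.
  have -> : k *: x + y = vquot_pi (k *: vquot_repr x + vquot_repr y).
    by rewrite linearP /= !vquot_reprK.
  by rewrite compl_proj_repr !linearP.
exists (fun r : 'rV_(\dim (W^C)%VS) =>
          vquot_pi (\sum_i r 0 i *: (vbasis (W^C)%VS)`_i)).
  move=> x /=; rewrite -[RHS]vquot_reprK; apply/eqP.
  rewrite vquot_piE -opprB rpredN.
  have -> : \sum_i (\row_i0 coord (vbasis (W^C)%VS) i0
     (compl_proj (vquot_repr x))) 0 i *: (vbasis (W^C)%VS)`_i
     = compl_proj (vquot_repr x).
    rewrite [RHS](coord_vbasis (memv_pi _ _ _)).
    by apply: eq_bigr => i _; rewrite mxE.
  exact: compl_proj_sub.
move=> r; apply/rowP=> i; rewrite mxE compl_proj_repr /compl_proj daddv_pi_id //.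
  by rewrite coord_sum_free ?(basis_free (vbasisP _)).
by apply: rpred_sum => j _; rewrite rpredZ ?vbasis_mem ?memt_nth.
Qed.
HB.instance Definition _ := Lmodule_hasFinDim.Build K vquot vquot_vect_axiom.

Lemma dim_vquot : \dim {:vquot} = (\dim {:vT} - \dim W)%N.
Proof. by rewrite dimvf -dimv_compl. Qed.

End VQuotient.

(* A left module over an algebra with underlying vector space [A] is given by
   its action [act : A -> V -> V]; the regular module is the product itself.
   The algebras below contain the scalars, so submodules are subspaces. *)

Section Modules.
Variables (K : fieldType) (A : Type) (V : vectType K) (act : A -> V -> V).

Definition submodule (U : {vspace V}) : Prop :=
  forall a v, v \in U -> act a v \in U.

(* Actions induced on a submodule [U] and on the quotient by a submodule [W];
   [vsproj U] only serves to retype a vector lying in [U]. *)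
Definition sub_act (U : {vspace V}) (a : A) (u : subvs_of U) : subvs_of U :=
  vsproj U (act a (vsval u)).

Definition quo_act (W : {vspace V}) (a : A) (x : vquot W) : vquot W :=
  vquot_pi W (act a (vquot_repr x)).

Definition simple_module : Prop :=
  {:V}%VS != 0%VS /\
  forall U : {vspace V}, submodule U -> U = 0%VS \/ U = {:V}%VS.

End Modules.

Definition semisimple_module (K : fieldType) (A : Type) (V : vectType K)
    (act : A -> V -> V) : Prop :=
  exists (m : nat) (S : 'I_m -> {vspace V}),
    [/\ forall i, submodule act (S i),
        forall i, simple_module (sub_act act (U := S i)),
        directv (\sum_(i < m) S i)
      & (\sum_(i < m) S i)%VS = {:V}%VS].

Definition noncrossing (T : finType) (pos : T -> nat) (P : {set {set T}}) :=
  [forall B in P, forall C in P, (B != C) ==>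
    ~~ [exists b in B, exists c in C, exists b' in B, exists c' in C,
          (pos b < pos c)%N && (pos c < pos b')%N && (pos b' < pos c')%N]].

Definition nc_small (T : finType) (pos : T -> nat) (P : {set {set T}}) :=
  [&& partition P [set: T], noncrossing pos P & [forall B in P, (#|B| <= 2)%N]].

(* The finest partition of [X] for which every set in [E] lies in a block:
   the connected components of the picture with pieces [E]. *)
Definition components (X : finType) (E : {set {set X}}) : {set {set X}} :=
  equivalence_partition
    (connect [rel x y | [exists B in E, (x \in B) && (y \in B)]]) [set: X].

(* Diagrams: [inl i] is the upper point [i], [inr i] the lower point [i'],
   in the order 1 < ... < n < n' < ... < 1'. *)

Definition diag_pos n (x : 'I_n + 'I_n) : nat :=
  match x with inl i => i | inr i => n + (n.-1 - i) end.

Definition diagram n : finType :=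
  {P : {set {set 'I_n + 'I_n}} | nc_small (@diag_pos n) P}.

(* [v.1] is the partition and [v.2] its set of defects; the singletons outside
   [v.2] are the proper ones. *)
Definition is_link_state n (v : {set {set 'I_n}} * {set 'I_n}) : bool :=
  nc_small (@nat_of_ord n) v.1 &&
  [forall j in v.2, ([set j] \in v.1) &&
     [forall i : 'I_n, forall k : 'I_n,
        (i < j < k)%N ==> ([set i; k] \notin v.1)]].

Definition link_state n : finType :=
  {v : {set {set 'I_n}} * {set 'I_n} | is_link_state v}.

Definition blocks n (v : link_state n) : {set {set 'I_n}} := (val v).1.
Definition defects n (v : link_state n) : {set 'I_n} := (val v).2.

Section Stack.
Variable n : nat.

(* Three rows of points: upper [inl (inl i)], middle [inl (inr i)] and lower
   [inr i]. *)
Let row3 : finType := ('I_n + 'I_n + 'I_n)%type.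

Definition top_emb (x : 'I_n + 'I_n) : row3 := inl x.
Definition bot_emb (x : 'I_n + 'I_n) : row3 :=
  match x with inl i => inl (inr i) | inr i => inr i end.
Definition outer_emb (x : 'I_n + 'I_n) : row3 :=
  match x with inl i => inl (inl i) | inr i => inr i end.

Definition stack_comps (p q : diagram n) : {set {set row3}} :=
  components ([set top_emb @: (B : {set _}) | B in val p] :|:
              [set bot_emb @: (B : {set _}) | B in val q]).

Definition stack_blocks (p q : diagram n) : {set {set 'I_n + 'I_n}} :=
  [set outer_emb @^-1: (C : {set _}) | C in stack_comps p q] :\ set0.

Definition stack_loops (p q : diagram n) : nat :=
  #|[set C in stack_comps p q | outer_emb @^-1: (C : {set _}) == set0]|.

(* A diagram above a link state: [inl i] is on the upper boundary, [inr i] is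
   both a lower point of the diagram and a point of the link state. *)
Definition act_edges (p : diagram n) (v : link_state n) :
    {set {set 'I_n + 'I_n}} :=
  val p :|: [set inr @: (B : {set 'I_n}) | B in blocks v].

Definition upper (C : {set 'I_n + 'I_n}) : {set 'I_n} := inl @^-1: C.
Definition has_defect (v : link_state n) (C : {set 'I_n + 'I_n}) : bool :=
  [exists j in defects v, inr j \in C].

Definition act_comps (p : diagram n) (v : link_state n) :=
  components (act_edges p v).

Definition act_link (p : diagram n) (v : link_state n) :
    {set {set 'I_n}} * {set 'I_n} :=
  ([set upper C | C in act_comps p v] :\ set0,
   [set j | [exists C in act_comps p v,
               (upper C == [set j]) && has_defect v C]]).

Definition act_loops (p : diagram n) (v : link_state n) : nat :=
  #|[set C in act_comps p v | (upper C == set0) && ~~ has_defect v C]|.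

Lemma components_trivIset (X : finType) (E : {set {set X}}) :
  trivIset (components E).
Proof.
rewrite /components; set e := connect _.
have eqe : {in [set: X] & &, equivalence_rel e}.
  have symE : connect_sym [rel x y | [exists B in E, (x \in B) && (y \in B)]].
    apply: sym_connect_sym => x y /=; apply: eq_existsb => B.
    by rewrite [(x \in _) && _]andbC.
  move=> x y z _ _ _; split; first exact: connect0.
  by move=> xy; apply: (same_connect symE).
by have /and3P[] := equivalence_partitionP eqe.
Qed.

Lemma act_link_defects p v w :
  val w = act_link p v -> (#|defects w| <= #|defects v|)%N.
Proof.
move=> ew; pose P j i := [exists C in act_comps p v,
  (upper C == [set j]) && (inr i \in C)].
pose f j := odflt j [pick i in defects v | P j i].
have fP j : j \in defects w -> f j \in defects v /\ P j (f j).
  rewrite /defects ew inE => /exists_inP[C Cc /andP[uC]].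
  rewrite /has_defect => /exists_inP[i iv iC].
  rewrite /f; case: pickP => [k /andP[] //|/(_ i)].
  suff Pji : P j i by rewrite iv Pji.
  by apply/exists_inP; exists C; rewrite ?uC.
rewrite -(card_in_imset (f := f)) => [|j k /fP[_ /exists_inP[B Bc]]].
  by apply/subset_leq_card/subsetP=> _ /imsetP[j /fP[]] jd _ ->.
move=> /andP[/eqP uB fB] /fP[_ /exists_inP[C Cc /andP[/eqP uC fC]]] fjk.
apply/eqP; rewrite -in_set1 -uC; suff -> : C = B by rewrite uB set11.
have tI : trivIset (act_comps p v) by exact: components_trivIset.
by rewrite -(def_pblock tI Bc fB) -(def_pblock tI Cc fC) fjk.
Qed.

End Stack.

Section Algebra.
Variables (R : realType) (delta : R) (n : nat).
Local Notation C := R[i].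

Definition alg : vectType C := {ffun diagram n -> C^o}.
Definition link_space : vectType C := {ffun link_state n -> C^o}.

(* [stack_blocks p q] is always a diagram and [act_link p v] always a link
   state, so exactly one coefficient of the two functions below is nonzero. *)
Definition mul_basis (p q : diagram n) : alg :=
  [ffun r => if val r == stack_blocks p q
             then (delta%:C) ^+ stack_loops p q else 0].

Definition act_basis (p : diagram n) (v : link_state n) : link_space :=
  [ffun w => if val w == act_link p v
             then (delta%:C) ^+ act_loops p v else 0].

Definition alg_mul (a b : alg) : alg :=
  \sum_p \sum_q (a p * b q) *: mul_basis p q.

Definition link_act (a : alg) (x : link_space) : link_space :=
  \sum_p \sum_v (a p * x v) *: act_basis p v.

Definition link_vec (v : link_state n) : link_space :=
  [ffun w => (w == v)%:R].

Definition M (d : nat) : {vspace link_space} :=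
  <<[seq link_vec v | v <- enum (link_state n) & (#|defects v| <= d)%N]>>%VS.

Lemma M_submodule (d : nat) : submodule link_act (M d).
Proof.
move=> a x xM; rewrite /link_act; apply: rpred_sum => p _.
have xs v : x v != 0 -> (#|defects v| <= d)%N.
  apply: contraNT => dv; move: xM; rewrite /M; set L := map _ _ => xL.
  have {}xL : x \in <<in_tuple L>>%VS by [].
  rewrite (coord_span xL) sum_ffunE; apply/eqP/big1 => i _; rewrite ffunE.
  have /mapP[u] := mem_nth 0 (ltn_ord i).
  rewrite mem_filter => /andP[ud _] /= ->; rewrite ffunE; case: eqP => [vu|_].
    by rewrite vu ud in dv.
  by rewrite scaler0.
apply: rpred_sum => v _; have [->|/xs dv] := eqVneq (x v) 0.
  by rewrite mulr0 scale0r mem0v.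
apply: rpredZ.
have -> : act_basis p v = \sum_w act_basis p v w *: link_vec w.
  apply/ffunP=> u; rewrite sum_ffunE (bigD1 u) //= big1 => [|w wu].
    by rewrite addr0 2!ffunE [link_vec u u]ffunE eqxx /= [_ *: _]mulr1.
  by rewrite ffunE [link_vec w u]ffunE eq_sym (negbTE wu) scaler0.
apply: rpred_sum => w _; rewrite ffunE; case: eqP => [/act_link_defects wv|_].
  apply/rpredZ/memv_span/map_f; rewrite mem_filter mem_enum andbT.
  exact: leq_trans wv dv.
by rewrite scale0r mem0v.
Qed.

(* M_(n,d-1), which is 0 when d = 0, inside M_(n,d). *)
Definition M_pred (d : nat) : {vspace subvs_of (M d)} :=
  (linfun (@vsval _ _ (M d)) @^-1: (if d is e.+1 then M e else 0))%VS.

Definition V (d : nat) : vectType C := vquot (M_pred d).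

Definition V_act (d : nat) : alg -> V d -> V d :=
  quo_act (sub_act link_act (U := M d)) (W := M_pred d).

End Algebra.

Definition generic (R : realType) (delta : R) : Prop :=
  (0 < delta)%R /\ forall n : nat, semisimple_module (@alg_mul R delta n).

(* 'C(N, a / 2), with value 0 when a is odd. *)
Definition bin_half (N a : nat) : nat := if odd a then 0%N else 'C(N, a./2).

Definition m_nd (n d : nat) : int :=
  \sum_(0 <= k < n.+1)
    'C(n, k)%:Z * ((bin_half (n - k) (n - k + d))%:Z
                   - (bin_half (n - k) (n - k + d + 2))%:Z).

(* A step: [None] is (1,0), [Some true] is (1,1), [Some false] is (1,-1).  A
   path from (0,0) to (n,0) has exactly n steps. *)
Definition rise (s : option bool) : int :=
  match s with None => 0 | Some true => 1 | Some false => - 1 end.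

Definition height (w : seq (option bool)) : int := \sum_(s <- w) rise s.

Definition motzkin (n : nat) : nat :=
  #|[set w : n.-tuple (option bool) |
      [forall k : 'I_n.+1, 0 <= height (take k w)] && (height w == 0)]|.

(* Main.v *)
Require Import Defs.
From HB Require Import structures.
From mathcomp Require Import all_boot all_order all_algebra complex reals.
From mathcomp Require Import zify ring.

Set Implicit Arguments.
Unset Strict Implicit.
Unset Printing Implicit Defensive.
Import GRing.Theory.

(** Write [V] for the cell module with [d] defects. Its simplicity and its
    dimension are independent.

    Simplicity. Let [v0] be the link state all of whose points are singletons,
    the first [d] being the defects. For every link state [w] with [d] defects
    there is a diagram [p] with [p v0] equal to [w] up to a power of [delta]
    ([act_link_thread]), so [v0] generates [V]. The diagram [e] so attached to
    [v0] itself maps [V] into the line of [v0] ([cell_act_basis]), and [e v0] is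
    a nonzero multiple of [v0] because [delta] is positive; hence a submodule
    not killed by [e] is all of [V]. The map [a |-> a v0] is a surjective
    homomorphism from the regular module, which is a direct sum of simple
    submodules, to [V]. One of these has an image not killed by [e]; it maps
    onto [V], and so [V] is simple ([simple_quotient_of_semisimple]).

    That [a |-> a v0] is a homomorphism means [(p q) v0 = p (q v0)] for diagrams
    [p] and [q]. Since [v0] has no arcs, the components of [q] above [v0] are the
    blocks of [q], and both sides can be read off the components of the
    three-row picture of [p] above [q] ([act_link_stack], [act_loops_stack]).

    This presupposes that the picture of [p] above [q] yields a diagram again
    ([stack_is_diagram]). Its components are the orbits of two involutions, hence
    paths or cycles, so that a component has at most two outer points, and has no
    singletons of [p] or [q] if it has two. Planarity is a parity argument. For
    two such components, the number of pairs of points, one of each, that are in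
    increasing order along the boundary of [p] is even, because [p] is
    noncrossing; the same holds for [q]. In the sum the middle row cancels, so
    the number is even along the outer boundary as well, whereas it would be 3 if
    the two components crossed there.

    Dimension. The link states with [d] defects index a basis of [V] ([dim_V]).
    Reading the left ends of arcs and the defects as up steps, the right ends of
    arcs as down steps and the proper singletons as flat steps turns them
    bijectively into the nonnegative paths ending at height [d]
    ([card_link_states]): the arcs are recovered by matching each down step with
    the latest unmatched up step. The number of these paths and [m_nd n d] satisfy
    the same recursion in [n] ([card_height_wordsS], [m_ndS]), and for [d = 0]
    the paths are the Motzkin paths. *)

(** * Partitions into singletons and pairs *)

Section Mate.
Variables (T : finType) (P : {set {set T}}).

Definition mate (x : T) : T := odflt x [pick y in pblock P x | y != x].

Hypotheses (partP : partition P [set: T]).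
Hypotheses (P2 : [forall B in P, #|B| <= 2]).

Lemma mem_pblockT x : x \in pblock P x.
Proof. by rewrite mem_pblock (cover_partition partP) inE. Qed.

Lemma pblockT_mem x : pblock P x \in P.
Proof. by rewrite pblock_mem // (cover_partition partP) inE. Qed.

Lemma pblock_mate x : pblock P x = [set x; mate x].
Proof.
have xB := mem_pblockT x.
rewrite /mate; case: pickP => [y /andP[yB yx]|none] /=.
  apply/esym/eqP; rewrite eqEcard; apply/andP; split.
    by apply/subsetP=> z; rewrite !inE => /orP[]/eqP->.
  by rewrite cards2 eq_sym yx; apply: (forall_inP P2); apply: pblockT_mem.
apply/setP=> z; rewrite !inE orbb; apply/idP/eqP => [zB|->//].
by have := none z; rewrite zB /= => /negbFE/eqP.
Qed.

Lemma mateK : involutive mate.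
Proof.
move=> x; have : pblock P (mate x) = pblock P x.
  by apply: same_pblock (partition_trivIset partP) _; rewrite pblock_mate !inE eqxx orbT.
rewrite !pblock_mate => e.
have : x \in [set mate x; mate (mate x)] by rewrite e !inE eqxx.
rewrite !inE => /orP[]/eqP // ex.
by rewrite -!ex.
Qed.

Lemma mate_blockE (B : {set T}) x : x \in B -> (B \in P) = (B == [set x; mate x]).
Proof.
move=> xB; rewrite -pblock_mate; apply/idP/eqP => [BP|->]; last exact: pblockT_mem.
by rewrite (def_pblock (partition_trivIset partP) BP xB).
Qed.

Lemma mate_block x : [set x; mate x] \in P.
Proof. by rewrite -pblock_mate pblockT_mem. Qed.

End Mate.

(** * Connected components *)

Section Linked.
Variables (X : finType) (E : {set {set X}}).

Definition linked : rel X :=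
  connect [rel x y | [exists B in E, (x \in B) && (y \in B)]].

Lemma linked_sym : symmetric linked.
Proof.
apply: sym_connect_sym => x y /=; apply: eq_existsb => B.
by rewrite [(x \in _) && _]andbC.
Qed.

Lemma linked0 x : linked x x. Proof. exact: connect0. Qed.

Lemma linked_trans : transitive linked. Proof. exact: connect_trans. Qed.

Lemma linked_piece (B : {set X}) x y : B \in E -> x \in B -> y \in B -> linked x y.
Proof. by move=> BE xB yB; apply/connect1/exists_inP; exists B; rewrite ?xB. Qed.

Lemma linked_ind (Q : X -> Prop) x :
  Q x -> (forall (B : {set X}) y z, B \in E -> y \in B -> z \in B -> Q y -> Q z) ->
  forall y, linked x y -> Q y.
Proof.
move=> Qx step y /connectP[s sx ->]; elim: s x Qx sx => //= z s IH x Qx.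
case/andP=> /exists_inP[B BE /andP[xB zB]]; apply: IH.
exact: step BE xB zB Qx.
Qed.

Definition linked_class x : {set X} := [set y | linked x y].

Lemma linked_classP (C : {set X}) :
  reflect (exists x, C = linked_class x) (C \in components E).
Proof.
apply: (iffP imsetP) => [[x _ ->]|[x ->]]; exists x => //.
  by apply/setP=> y; rewrite !inE.
by apply/setP=> y; rewrite !inE.
Qed.

Lemma components_partition : partition (components E) [set: X].
Proof.
apply: equivalence_partitionP => x y z _ _ _; split; first exact: connect0.
by move=> xy; apply: (same_connect linked_sym xy).
Qed.

Lemma mem_component (C : {set X}) x : C \in components E -> x \in C -> C = linked_class x.
Proof.
move=> /linked_classP[y ->]; rewrite inE => yx.
by apply/setP=> z; rewrite !inE; apply: (same_connect linked_sym yx).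
Qed.

Lemma class_component x : linked_class x \in components E.
Proof. by apply/linked_classP; exists x. Qed.

Lemma mem_class x : x \in linked_class x.
Proof. by rewrite inE linked0. Qed.

End Linked.

(** * Orbits of two involutions *)

Section Dihedral.
Variables (T : finType).
Implicit Types a b : T -> T.

Definition dihedral a b : rel T := connect [rel x y | (y == a x) || (y == b x)].

Lemma dihedral_sym a b : involutive a -> involutive b -> symmetric (dihedral a b).
Proof.
move=> aK bK; apply: sym_connect_sym => x y /=.
by apply/idP/idP => /orP[]/eqP->; rewrite ?aK ?bK eqxx ?orbT.
Qed.

Lemma dihedralC a b : dihedral a b =2 dihedral b a.
Proof. by apply: eq_connect => x y; rewrite /= orbC. Qed.

(** Points fixed by [a] and points fixed by [b] are counted separately: a common
    fixed point contributes 2, as a path of length zero has two ends. *)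
Definition flags a b (C : {pred T}) :=
  #|[set y in C | a y == y]| + #|[set y in C | b y == y]|.

(** Starting from a fixed point [x] of [a], the orbit is the cycle of [x] under
    [r := b \o a]. On this cycle, read as the integers modulo its length [m],
    [a] is [k |-> - k] and [b] is [k |-> 1 - k], so that the fixed points solve
    [2 k = 0] or [2 k = 1] modulo [m]: one solution of each kind if [m] is odd, two
    of the first kind if [m] is even. *)
Lemma flags_from_fixpoint a b x :
  involutive a -> involutive b -> a x = x -> flags a b (dihedral a b x) <= 2.
Proof.
move=> aK bK ax; pose r y := b (a y); pose m := order r x.
have r_inj : injective r by move=> y z /(inv_inj bK)/(inv_inj aK).
have mx : iter m r x = x by rewrite iter_order.
have m_gt0 : 0 < m by apply: order_gt0.
have inj_it k : injective (iter k r).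
  by elim: k => //= k IH y z /r_inj /IH.
have ar k : iter k r (a (iter k r x)) = x.
  elim: k => //= k IH; rewrite -iterS iterSr.
  have -> : r (a (r (iter k r x))) = a (iter k r x) by rewrite /r aK bK.
  exact: IH.
have aE k : k <= m -> a (iter k r x) = iter (m - k) r x.
  by move=> km; apply: (inj_it k); rewrite ar -iterD subnKC.
have bE k : k <= m -> b (iter k r x) = iter (m - k).+1 r x.
  by move=> km; rewrite /= -aE // /r aK.
have itm k : k < m -> findex r x (iter k r x) = k by apply: findex_iter.
have inC y : dihedral a b x y -> {k | k < m & y = iter k r x}.
  move=> xy; suff h : fconnect r x y.
    by exists (findex r x y); rewrite ?iter_findex ?findex_max.
  have /connectP[s sx ->] := xy.
  suff main w : fconnect r x w -> path [rel x y | (y == a x) || (y == b x)] w s ->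
      fconnect r x (last w s) by apply: main sx; apply: connect0.
  elim: s w {sx xy} => //= z s IH w xw /andP[ewz sz]; apply: IH sz.
  have km : findex r x w < m by apply: findex_max.
  rewrite -(iter_findex xw) in ewz; move: ewz.
  by case/orP=> /eqP->; rewrite ?aE ?bE ?(ltnW km) // fconnect_iter.
rewrite /flags; have [m_odd|m_even] := boolP (odd m).
  have sa : [set y in dihedral a b x | a y == y] \subset [set x].
    apply/subsetP=> y; rewrite !inE => /andP[/inC[k km ->]].
    rewrite aE 1?ltnW // => /eqP e; case: k km e => // k km e.
    have := congr1 (findex r x) e; rewrite !itm //; last by lia.
    by move: m_odd; lia.
  have sb : [set y in dihedral a b x | b y == y] \subset [set iter m.+1./2 r x].
    apply/subsetP=> y; rewrite !inE => /andP[/inC[k km ->]].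
    rewrite bE 1?ltnW // => /eqP e.
    case: (posnP k) e => [->|k0 e].
      rewrite subn0 iterS mx /= => rx.
      have h j : iter j r x = x by elim: j => //= j ->.
      by rewrite h.
    case: (ltnP 1 k) => [k1|k1].
      have := congr1 (findex r x) e; rewrite !itm //; last by lia.
      by move=> ek; apply/eqP; congr (iter _ r x); lia.
    have k1' : k = 1 by lia.
    move: e; rewrite k1' subn1 prednK // mx /= => rx.
    have h j : iter j r x = x by elim: j => //= j ->.
    by rewrite /= -rx h.
  apply: (leq_trans (leq_add (subset_leq_card sa) (subset_leq_card sb))).
  by rewrite !cards1.
have sa : [set y in dihedral a b x | a y == y] \subset [set x; iter m./2 r x].
  apply/subsetP=> y; rewrite !inE => /andP[/inC[k km ->]].
  rewrite aE 1?ltnW // => /eqP e; case: k km e => [|k km e]; first by rewrite eqxx.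
  have := congr1 (findex r x) e; rewrite !itm //; last by lia.
  by move=> ek; apply/orP; right; apply/eqP; congr (iter _ r x); lia.
have sb : [set y in dihedral a b x | b y == y] = set0.
  apply/setP=> y; rewrite !inE; apply/negP => /andP[/inC[k km ->]].
  rewrite bE 1?ltnW // => /eqP e.
  case: (posnP k) e => [->|k0 e].
    rewrite subn0 iterS mx => rx.
    have := congr1 (findex r x) rx; rewrite (@itm 1) ?(@itm 0) //; lia.
  have := congr1 (findex r x) e.
  case: (ltnP 1 k) => [k1|k1]; first by rewrite !itm //; lia.
  have k1' : k = 1 by lia.
  rewrite k1' subn1 prednK // mx -[X in findex _ _ X = _]/(iter 0 r x).
  by rewrite !itm //; lia.
rewrite sb cards0 addn0 (leq_trans (subset_leq_card sa)) // cards2.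
by case: (_ != _).
Qed.

(** The orbit of a point under two involutions is a path or a cycle, and the fixed
    points are the ends of the path. *)
Lemma dihedral_flags a b x :
  involutive a -> involutive b -> flags a b (dihedral a b x) <= 2.
Proof.
move=> aK bK.
have main c d : involutive c -> involutive d ->
    [set y in dihedral c d x | c y == y] != set0 -> flags c d (dihedral c d x) <= 2.
  move=> cK dK /set0Pn[z]; rewrite inE => /andP[xz /eqP cz].
  have := flags_from_fixpoint cK dK cz; rewrite /flags.
  have e y : (y \in dihedral c d z) = (y \in dihedral c d x).
    by apply/esym; apply: (same_connect (dihedral_sym cK dK) xz).
  have es f : [set y in dihedral c d z | f y == y] = [set y in dihedral c d x | f y == y].
    by apply/setP=> y; rewrite !inE; congr andb; apply: e.
  by rewrite !es.
have [a0|] := eqVneq [set y in dihedral a b x | a y == y] set0; last exact: main.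
have [b0|bn0] := eqVneq [set y in dihedral a b x | b y == y] set0.
  by rewrite /flags a0 b0 cards0.
have := main b a bK aK; rewrite /flags addnC.
have e z : (z \in dihedral b a x) = (z \in dihedral a b x).
  exact: dihedralC.
have es c : [set y in dihedral b a x | c y == y] = [set y in dihedral a b x | c y == y].
  by apply/setP=> z; rewrite !inE; congr andb; apply: e.
by rewrite !es => /(_ bn0).
Qed.

End Dihedral.

(** * Parity of crossings *)

Lemma trace_partition (X Y : finType) (f : Y -> X) (P : {set {set X}}) :
  partition P [set: X] ->
  partition ([set f @^-1: (C : {set X}) | C in P] :\ set0) [set: Y].
Proof.
case/and3P=> /eqP covP tI _; apply/and3P; split; last by rewrite !inE eqxx.
  apply/eqP/setP=> y; rewrite inE; have : f y \in cover P by rewrite covP inE.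
  case/bigcupP=> C CP yC; apply/bigcupP; exists (f @^-1: C); last by rewrite inE.
  rewrite in_setD1 imset_f // andbT; apply/set0Pn; exists y; by rewrite inE.
apply/trivIsetP=> B C /setD1P[_ /imsetP[B' B'P ->]] /setD1P[_ /imsetP[C' C'P ->]] BC.
have BC' : B' != C' by apply: contraNneq BC => ->.
rewrite -setI_eq0 -preimsetI; have := trivIsetP tI _ _ B'P C'P BC'.
by rewrite -setI_eq0 => /eqP->; apply/eqP/setP=> y; rewrite !inE.
Qed.

Section Parity.
Variables (T : finType) (pos : T -> nat) (s : T -> T).
Hypotheses (pos_inj : injective pos) (sK : involutive s).

Definition paired (A : {set T}) := {in A, forall x, s x \in A /\ s x != x}.

(** The sum over [A] splits into equal halves exchanged by [s]: the points that
    precede their partner, and those that follow it. *)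
Lemma xor_paired (A : {set T}) (F : T -> bool) :
  paired A -> {in A, forall x, F (s x) = F x} ->
  \big[addb/false]_(x in A) F x = false.
Proof.
move=> sA sF; rewrite (bigID (fun x => pos x < pos (s x))) /=.
rewrite [X in _ (+) X](reindex_inj (inv_inj sK)) /=.
rewrite [X in _ (+) X](eq_big (fun x => (x \in A) && (pos x < pos (s x))) F) ?addbb //.
  move=> x; rewrite sK; apply/andP/andP=> -[xA lt].
    have := sA _ xA; rewrite sK => -[xA' /eqP ne]; split=> //.
    have ne' : pos x <> pos (s x) by move/pos_inj.
    lia.
  by have [? _] := sA _ xA; split=> //; lia.
by move=> x /andP[xA _]; rewrite -(sF _ xA) sK.
Qed.

(** For fixed [a], the number of [b] lying between [a] and [s a] is even, because
    [b] and [s b] lie between them together. So the parity of the number of [b]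
    after [a] is the same as after [s a], and [xor_paired] applies again. *)
Lemma xor_before_paired (A B : {set T}) :
  paired A -> paired B -> [disjoint A & B] ->
  {in A & B, forall a b, pos a < pos b -> pos b < pos (s a) ->
     pos a < pos (s b) < pos (s a)} ->
  \big[addb/false]_(a in A) \big[addb/false]_(b in B) (pos a < pos b) = false.
Proof.
move=> sA sB dAB nc; apply: xor_paired => // a aA.
suff : \big[addb/false]_(b in B) ((pos (s a) < pos b) (+) (pos a < pos b)) = false.
  by rewrite big_split /=; do 2!case: (\big[addb/false]_(b in B) _).
apply: xor_paired => // b bB.
have ne x y : x \in A -> y \in B -> pos x <> pos y.
  by move=> xA yB /pos_inj xy; have := disjointFr dAB xA; rewrite xy yB.
have [saA _] := sA a aA; have [sbB _] := sB b bB.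
have := nc a b aA bB; have := nc (s a) b saA bB.
have := nc a (s b) aA sbB; have := nc (s a) (s b) saA sbB; rewrite !sK.
have := ne a b aA bB; have := ne (s a) b saA bB.
have := ne a (s b) aA sbB; have := ne (s a) (s b) saA sbB.
lia.
Qed.

End Parity.

Lemma nc_small_uncrossed (T : finType) (pos : T -> nat) (P : {set {set T}})
    (B C : {set T}) x y z t :
  nc_small pos P -> B \in P -> C \in P -> B != C ->
  x \in B -> y \in C -> z \in B -> t \in C ->
  pos x < pos y -> pos y < pos z -> pos z < pos t -> False.
Proof.
case/and3P=> _ nc _ BP CP BC xB yC zB tC xy yz zt.
have /implyP/(_ BC)/negP := forall_inP (forall_inP nc _ BP) _ CP; apply.
apply/exists_inP; exists x => //; apply/exists_inP; exists y => //.
apply/exists_inP; exists z => //; apply/exists_inP; exists t => //.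
by rewrite xy yz zt.
Qed.

Lemma noncrossing_mate (T : finType) (pos : T -> nat) (P : {set {set T}}) a b :
  nc_small pos P ->
  pos a < pos b -> pos b < pos (mate P a) ->
  pos a <= pos (mate P b) <= pos (mate P a).
Proof.
move=> ncP lt1 lt2; have /and3P[partP _ P2] := ncP.
set sa := mate P a; set sb := mate P b.
have BP : [set a; sa] \in P by exact: mate_block.
have CP : [set b; sb] \in P by exact: mate_block.
have BC : [set a; sa] != [set b; sb].
  apply/negP=> /eqP e; have : b \in [set a; sa] by rewrite e !inE eqxx.
  by rewrite !inE => /orP[]/eqP eb; move: lt1 lt2; rewrite eb ltnn.
apply/andP; split; rewrite leqNgt; apply/negP=> lt.
  apply: (nc_small_uncrossed ncP CP BP _ (set22 b sb) (set21 a sa) (set21 b sb) (set22 a sa)) => //.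
  by rewrite eq_sym.
exact: (nc_small_uncrossed ncP BP CP BC (set21 a sa) (set21 b sb) (set22 a sa) (set22 b sb)).
Qed.

Lemma diag_pos_inj n : injective (@diag_pos n).
Proof.
move=> [i|i] [j|j] /= e; try congr inl; try congr inr; try apply: val_inj;
  move: (ltn_ord i) (ltn_ord j) => /=; lia.
Qed.

Section RowParity.
Variable n : nat.
Implicit Types A B : {set 'I_n}.

Definition par A := \big[addb/false]_(x in A) true.
Definition before A B := \big[addb/false]_(a in A) \big[addb/false]_(b in B) (a < b).
(** For the lower row, which the boundary order of a diagram runs through
    backwards. *)
Definition after A B := \big[addb/false]_(a in A) \big[addb/false]_(b in B) (b < a).

Lemma before_after A B : [disjoint A & B] -> after A B = before A B (+) par A && par B.
Proof.
move=> dAB; rewrite /par big_distrlr /= -big_split; apply: eq_bigr => a aA /=.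
rewrite -big_split; apply: eq_bigr => b bB /=.
have : (a : nat) <> b.
  by move=> /val_inj ab; have := disjointFr dAB aA; rewrite ab bB.
lia.
Qed.

Definition lower (C : {set 'I_n + 'I_n}) : {set 'I_n} := inr @^-1: C.

(** All upper points precede all lower ones, whence the product of the parities. *)
Lemma diag_before (C D : {set 'I_n + 'I_n}) :
  \big[addb/false]_(a in C) \big[addb/false]_(b in D) (diag_pos a < diag_pos b) =
  before (upper C) (upper D) (+) (par (upper C) && par (lower D)) (+)
  after (lower C) (lower D).
Proof.
have sumE (F : 'I_n + 'I_n -> bool) (S : {set 'I_n + 'I_n}) :
   \big[addb/false]_(a in S) F a =
   \big[addb/false]_(i in upper S) F (inl i) (+) \big[addb/false]_(i in lower S) F (inr i).
  by rewrite big_sumType; congr addb; apply: eq_bigl => i; rewrite inE.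
rewrite sumE; congr addb.
  rewrite /par big_distrlr /= -big_split; apply: eq_bigr => a _ /=.
  rewrite sumE /=; congr addb; apply: eq_bigr => b _.
  by have := ltn_ord a; lia.
apply: eq_bigr => a _; rewrite sumE /= big1 => [|b _]; last first.
  by apply/negbTE; have := ltn_ord b; lia.
rewrite addFb; apply: eq_bigr => b _.
by have := ltn_ord a; have := ltn_ord b; lia.
Qed.

Lemma par_diag (C : {set 'I_n + 'I_n}) :
  \big[addb/false]_(a in C) true = par (upper C) (+) par (lower C).
Proof. by rewrite big_sumType; congr addb; apply: eq_bigl => i; rewrite inE. Qed.

End RowParity.

(** * The composite of two diagrams *)

Lemma diagram_partition n (p : diagram n) : partition (val p) setT.
Proof. by have /and3P[] := valP p. Qed.

Lemma diagram_card2 n (p : diagram n) : [forall B in val p, #|B| <= 2].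
Proof. by have /and3P[] := valP p. Qed.

Local Notation dmate p := (mate (val p)).

Lemma dmateK n (p : diagram n) : involutive (dmate p).
Proof. exact: mateK (diagram_partition p) (diagram_card2 p). Qed.

Lemma dmate_blockE n (p : diagram n) (B : {set 'I_n + 'I_n}) x :
  x \in B -> (B \in val p) = (B == [set x; dmate p x]).
Proof. exact: mate_blockE (diagram_partition p) (diagram_card2 p) _ _. Qed.

Lemma dmate_block n (p : diagram n) x : [set x; dmate p x] \in val p.
Proof. exact: mate_block (diagram_partition p) (diagram_card2 p) _. Qed.

Lemma outer_emb_inj n : injective (@outer_emb n).
Proof. by case=> i [] j //= [->]. Qed.

Lemma bot_emb_inj n : injective (@bot_emb n).
Proof. by case=> i [] j //= [->]. Qed.

Section StackDiagram.
Variables (n : nat) (p q : diagram n).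

Local Notation row3 := ('I_n + 'I_n + 'I_n)%type.
Local Notation pieces := ([set @top_emb n @: (B : {set _}) | B in val p] :|:
              [set @bot_emb n @: (B : {set _}) | B in val q]).

Definition step_top (x : row3) : row3 :=
  if x is inl y then inl (dmate p y) else x.

Definition step_bot (x : row3) : row3 :=
  match x with
  | inl (inl _) => x
  | inl (inr i) => bot_emb (dmate q (inl i))
  | inr i => bot_emb (dmate q (inr i))
  end.

Lemma step_bot_emb y : step_bot (bot_emb y) = bot_emb (dmate q y).
Proof. by case: y. Qed.

Lemma step_topK : involutive step_top.
Proof. by case=> //= y; rewrite dmateK. Qed.

Lemma step_botK : involutive step_bot.
Proof. by case=> [[//|i]|i]; rewrite /= step_bot_emb dmateK. Qed.

(** All pieces are pairs or singletons, so the components of the picture of [p]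
    above [q] are the orbits of the two involutions [step_top] and [step_bot], one
    exchanging the ends of each arc of [p], the other those of each arc of [q]. *)
Lemma linked_dihedral : linked pieces =2 dihedral step_top step_bot.
Proof.
have sub1 x y : linked pieces x y -> dihedral step_top step_bot x y.
  move: y; apply: linked_ind; first exact: connect0.
  move=> B y z /setUP[]/imsetP[B' B'p ->] /imsetP[y' y'B ->] /imsetP[z' z'B ->] xy;
    apply: connect_trans xy _; move: z'B; move: B'p;
    rewrite (dmate_blockE _ y'B) => /eqP->; rewrite !inE => /orP[]/eqP->.
  - exact: connect0.
  - by apply: connect1; rewrite /= eqxx.
  - exact: connect0.
  - by apply: connect1; rewrite /= step_bot_emb eqxx orbT.
move=> x y; apply/idP/idP; first exact: sub1.
apply: connect_sub => {x y} x y /orP[]/eqP->.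
  case: x => [x|i] /=; last exact: linked0.
  apply: (@linked_piece _ _ (@top_emb n @: [set x; dmate p x])).
  - by apply/setUP; left; apply: imset_f; apply: dmate_block.
  - by apply: imset_f; rewrite !inE eqxx.
  - by apply: imset_f; rewrite !inE eqxx orbT.
have main z : linked pieces (bot_emb z) (bot_emb (dmate q z)).
  apply: (@linked_piece _ _ (@bot_emb n @: [set z; dmate q z])).
  - by apply/setUP; right; apply: imset_f; apply: dmate_block.
  - by apply: imset_f; rewrite !inE eqxx.
  - by apply: imset_f; rewrite !inE eqxx orbT.
by case: x => [[i|i]|i] /=; [exact: linked0|exact: main (inl i)|exact: main (inr i)].
Qed.

Lemma step_top_comp (C : {set row3}) x :
  C \in stack_comps p q -> x \in C -> step_top x \in C.
Proof.
move=> /mem_component CE xC; rewrite (CE _ xC) inE linked_dihedral.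
by apply: connect1; rewrite /= eqxx.
Qed.

Lemma step_bot_comp (C : {set row3}) x :
  C \in stack_comps p q -> x \in C -> step_bot x \in C.
Proof.
move=> /mem_component CE xC; rewrite (CE _ xC) inE linked_dihedral.
by apply: connect1; rewrite /= eqxx orbT.
Qed.

Lemma stack_flags (C : {set row3}) : C \in stack_comps p q ->
  #|[set x in C | step_top x == x]| + #|[set x in C | step_bot x == x]| <= 2.
Proof.
case/linked_classP=> x ->.
have := dihedral_flags x step_topK step_botK; rewrite /flags.
have eqC f : [set y in dihedral step_top step_bot x | f y == y] =
             [set y in linked_class pieces x | f y == y].
  by apply/setP=> y; rewrite !inE; congr andb; rewrite linked_dihedral.
by rewrite !eqC.
Qed.

Let is_lower (x : row3) := if x is inr _ then true else false.
Let is_upper (x : row3) := if x is inl (inl _) then true else false.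

(** A point of the lower row is fixed by [step_top] and one of the upper row by
    [step_bot]; the bound on fixed points thus becomes a bound on outer points. *)
Lemma stack_outer_leq (C : {set row3}) :
  #|@outer_emb n @^-1: C| <= #|[set x in C | is_lower x]| + #|[set x in C | is_upper x]|.
Proof.
rewrite -(card_imset _ (@outer_emb_inj n)).
apply: leq_trans (leq_card_setU _ _); apply: subset_leq_card.
apply/subsetP=> _ /imsetP[x xC ->]; move: xC; rewrite !inE => xC.
by case: x xC => i /= ->; rewrite ?orbT.
Qed.

Let lowerS (C : {set row3}) : [set x in C | is_lower x] \subset [set x in C | step_top x == x].
Proof. by apply/subsetP=> -[x|i]; rewrite !inE ?andbF //= eqxx. Qed.

Let upperS (C : {set row3}) : [set x in C | is_upper x] \subset [set x in C | step_bot x == x].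
Proof. by apply/subsetP=> -[[i|i]|i]; rewrite !inE ?andbF //= eqxx. Qed.

Lemma stack_outer2 (C : {set row3}) :
  C \in stack_comps p q -> #|@outer_emb n @^-1: C| <= 2.
Proof.
move=> /stack_flags h; apply: leq_trans (stack_outer_leq C) (leq_trans _ h).
exact: leq_add (subset_leq_card (lowerS C)) (subset_leq_card (upperS C)).
Qed.

(** Two outer points use up both fixed points that the component may have, so no
    further point of it can be a singleton of [p] or of [q]. *)
Lemma stack_no_singleton (C : {set row3}) :
  C \in stack_comps p q -> 1 < #|@outer_emb n @^-1: C| ->
  paired (dmate p) (@top_emb n @^-1: C) /\ paired (dmate q) (@bot_emb n @^-1: C).
Proof.
move=> CC C2; have h := stack_flags CC.
have h1 := stack_outer_leq C.
have h2 := subset_leq_card (lowerS C); have h3 := subset_leq_card (upperS C).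
have eL : [set x in C | is_lower x] = [set x in C | step_top x == x].
  by apply/eqP; rewrite eqEcard lowerS; lia.
have eU : [set x in C | is_upper x] = [set x in C | step_bot x == x].
  by apply/eqP; rewrite eqEcard upperS; lia.
split=> x; rewrite !inE => xC.
  split; first exact: (step_top_comp CC xC).
  apply/negP => /eqP e; have := in_setT (inl x : row3).
  have : inl x \in [set x in C | is_lower x] by rewrite eL inE xC /= e eqxx.
  by rewrite inE andbF.
split; first by rewrite -step_bot_emb; exact: (step_bot_comp CC xC).
apply/negP => /eqP e.
have : bot_emb x \in [set x in C | is_upper x].
  by rewrite eU inE xC step_bot_emb e eqxx.
by rewrite inE; case: (x) => i; rewrite andbF.
Qed.

Lemma diagram_before_even (r : diagram n) (C D : {set 'I_n + 'I_n}) :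
  paired (dmate r) C -> paired (dmate r) D -> [disjoint C & D] ->
  \big[addb/false]_(a in C) \big[addb/false]_(b in D) (diag_pos a < diag_pos b) = false.
Proof.
move=> rC rD dCD; apply: (xor_before_paired (@diag_pos_inj n) (dmateK r)) => //.
move=> a b aC bD l1 l2.
have := noncrossing_mate (valP r) l1 l2.
have ne x y : x \in C -> y \in D -> diag_pos x <> diag_pos y.
  by move=> xC yD /diag_pos_inj xy; have := disjointFr dCD xC; rewrite xy yD.
have [saC _] := rC a aC; have [sbD _] := rD b bD.
have n1 := ne _ _ aC sbD; have n2 := ne _ _ saC sbD.
move=> /andP[h1 h2]; rewrite !ltn_neqAle h1 h2 !andbT.
by apply/andP; split; apply/eqP=> // /esym.
Qed.

(** Add the parities of [diagram_before_even] for [p] and for [q]. The middle row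
    occurs once in each order, which leaves the product of its parities; as every such
    component meets the three rows in numbers of the same parity, what remains is
    the parity for the outer boundary. *)
Lemma stack_before_even (C D : {set row3}) :
  C \in stack_comps p q -> D \in stack_comps p q -> C != D ->
  1 < #|@outer_emb n @^-1: C| -> 1 < #|@outer_emb n @^-1: D| ->
  \big[addb/false]_(a in @outer_emb n @^-1: C)
   \big[addb/false]_(b in @outer_emb n @^-1: D) (diag_pos a < diag_pos b) = false.
Proof.
move=> CC DC CD C2 D2.
have [pC qC] := stack_no_singleton CC C2; have [pD qD] := stack_no_singleton DC D2.
have dCD : [disjoint C & D] by exact: (trivIsetP (components_trivIset _) _ _ CC DC CD).
have dpre (Y : finType) (f : Y -> row3) : [disjoint f @^-1: C & f @^-1: D].
  by rewrite -setI_eq0 -preimsetI; move: dCD; rewrite -setI_eq0 => /eqP->; apply/eqP/setP=> y; rewrite !inE.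
have := diagram_before_even pC pD (dpre _ _).
have := diagram_before_even qC qD (dpre _ _).
have parity (r : diagram n) (A : {set 'I_n + 'I_n}) : paired (dmate r) A ->
    par (upper A) (+) par (lower A) = false.
  by move=> rA; rewrite -par_diag (xor_paired (@diag_pos_inj n) (dmateK r)).
have := parity _ _ pC; have := parity _ _ pD.
have := parity _ _ qC; have := parity _ _ qD.
rewrite !diag_before.
pose T (A : {set row3}) := [set i | inl (inl i) \in A].
pose M (A : {set row3}) := [set i | inl (inr i) \in A].
pose L (A : {set row3}) := [set i | inr i \in A].
have tU (A : {set row3}) : upper (@top_emb n @^-1: A) = T A by apply/setP=> i; rewrite !inE.
have tL (A : {set row3}) : lower (@top_emb n @^-1: A) = M A by apply/setP=> i; rewrite !inE.
have bU (A : {set row3}) : upper (@bot_emb n @^-1: A) = M A by apply/setP=> i; rewrite !inE.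
have bL (A : {set row3}) : lower (@bot_emb n @^-1: A) = L A by apply/setP=> i; rewrite !inE.
have oU (A : {set row3}) : upper (@outer_emb n @^-1: A) = T A by apply/setP=> i; rewrite !inE.
have oL (A : {set row3}) : lower (@outer_emb n @^-1: A) = L A by apply/setP=> i; rewrite !inE.
rewrite !tU !tL !bU !bL !oU !oL (before_after (A := M C)).
  move: (before (T C) (T D)) (after (L C) (L D)) (before (M C) (M D)).
  move: (par (T C)) (par (M C)) (par (L C)) (par (T D)) (par (M D)) (par (L D)).
  by do 9!case.
have -> : M C = (fun i => inl (inr i)) @^-1: C by apply/setP=> i; rewrite !inE.
have -> : M D = (fun i => inl (inr i)) @^-1: D by apply/setP=> i; rewrite !inE.
exact: dpre.
Qed.

Lemma stack_is_diagram : nc_small (@diag_pos n) (stack_blocks p q).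
Proof.
apply/and3P; split; first exact/trace_partition/components_partition.
  apply/forall_inP=> B /setD1P[_ /imsetP[C CC eB]].
  apply/forall_inP=> B' /setD1P[_ /imsetP[D DC eB']].
  apply/implyP=> BB'; apply/negP.
  case/exists_inP=> b bB /exists_inP[c cB'] /exists_inP[b' b'B] /exists_inP[c' c'B'].
  case/andP=> /andP[bc cb' b'c'].
  have two (A : {set 'I_n + 'I_n}) x y : #|A| <= 2 -> x \in A -> y \in A ->
      diag_pos x < diag_pos y -> A = [set x; y].
    move=> A2 xA yA xy; apply/esym/eqP; rewrite eqEcard cards2.
    have -> : x != y by apply: contraTneq xy => ->; rewrite ltnn.
    by rewrite A2 andbT; apply/subsetP=> z; rewrite !inE => /orP[]/eqP->.
  (* Exactly three of the four pairs are in increasing order: an odd number. *)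
  have bb := ltn_trans bc cb'; have cc := ltn_trans cb' b'c'.
  have EB : B = [set b; b'] by apply: two bB b'B bb; rewrite eB stack_outer2.
  have EB' : B' = [set c; c'] by apply: two cB' c'B' cc; rewrite eB' stack_outer2.
  have nbb : b != b' by apply: contraTneq bb => ->; rewrite ltnn.
  have ncc : c != c' by apply: contraTneq cc => ->; rewrite ltnn.
  have CD : C != D by apply: contraNneq BB' => CD; rewrite eB eB' CD.
  have := stack_before_even CC DC CD; rewrite -eB -eB' EB EB' !cards2 nbb ncc.
  move=> /(_ isT isT); rewrite !big_setU1 ?inE //= !big_set1 !big_setU1 ?inE //= !big_set1.
  by rewrite bc (ltn_trans bc cc) b'c' ltnNge (ltnW cb').
by apply/forall_inP=> B /setD1P[_ /imsetP[C CC ->]]; apply: stack_outer2.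
Qed.

End StackDiagram.

(** * The link state without arcs *)

(** The pieces of [E] that are not blocks of [P] add no connections, being
    contained in blocks. *)
Lemma components_coarse (X : finType) (E P : {set {set X}}) :
  partition P [set: X] -> P \subset E ->
  (forall B, B \in E -> exists2 C, C \in P & B \subset C) -> components E = P.
Proof.
move=> partP /subsetP PE EP; have tI := partition_trivIset partP.
have covP x : x \in cover P by rewrite (cover_partition partP) inE.
have classE x : linked_class E x = pblock P x.
  apply/setP=> y; rewrite inE; apply/idP/idP => [|yx]; last first.
    by apply: (linked_piece (PE _ (pblock_mem (covP x)))); rewrite ?mem_pblock.
  move: y; apply: linked_ind; first by rewrite mem_pblock.
  move=> B y z /EP[C CP /subsetP BC] /BC yC /BC zC yx.
  by rewrite -(same_pblock tI yx) (def_pblock tI CP yC).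
apply/setP=> C; apply/linked_classP/idP => [[x ->]|CP].
  by rewrite classE pblock_mem.
have [x xC] : exists x, x \in C.
  by apply/set0Pn; apply: contraTneq CP => ->; have /and3P[] := partP.
by exists x; rewrite classE (def_pblock tI CP xC).
Qed.

Section InvolutionBlocks.
Variables (T : finType) (f : T -> T).
Hypothesis fK : involutive f.

Definition orbit_blocks : {set {set T}} := [set [set x; f x] | x : T].

Lemma orbit_blocks_mem (B : {set T}) x :
  B \in orbit_blocks -> x \in B -> B = [set x; f x].
Proof.
case/imsetP=> y _ ->; rewrite !inE => /orP[]/eqP-> //.
by rewrite fK setUC.
Qed.

Lemma orbit_blocks_partition : partition orbit_blocks [set: T].
Proof.
apply/and3P; split.
- apply/eqP/setP=> x; rewrite inE; apply/bigcupP; exists [set x; f x].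
    exact: imset_f.
  by rewrite !inE eqxx.
- apply/trivIsetP=> B C BP CP; apply: contraR => /pred0Pn[x /andP[/= xB xC]].
  by rewrite (orbit_blocks_mem BP xB) (orbit_blocks_mem CP xC).
- apply/negP=> /imsetP[x _ /setP/(_ x)]; by rewrite !inE eqxx.
Qed.

Lemma orbit_blocks_nc_small (pos : T -> nat) :
  (forall x y, pos x < pos y -> pos y < pos (f x) -> pos x < pos (f y) < pos (f x)) ->
  nc_small pos orbit_blocks.
Proof.
move=> nc; apply/and3P; split; first exact: orbit_blocks_partition.
  apply/forall_inP=> B BP; apply/forall_inP=> C CP; apply/implyP=> BC; apply/negP.
  case/exists_inP=> b bB /exists_inP[c cC] /exists_inP[b' b'B] /exists_inP[c' c'C].
  case/andP=> /andP[bc cb' b'c'].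
  have /esym eb : b' = f b.
    have := b'B; rewrite (orbit_blocks_mem BP bB) !inE => /orP[]/eqP // e.
    by move: bc cb'; rewrite e; lia.
  have /esym ec : c' = f c.
    have := c'C; rewrite (orbit_blocks_mem CP cC) !inE => /orP[]/eqP // e.
    by move: cb' b'c'; rewrite e; lia.
  by have := nc _ _ bc; rewrite eb ec => /(_ cb'); lia.
apply/forall_inP=> _ /imsetP[x _ ->]; rewrite cards2; by case: (_ != _).
Qed.

Lemma mate_orbit_blocks x : mate orbit_blocks x = f x.
Proof.
have pE : pblock orbit_blocks x = [set x; f x].
  apply: def_pblock (partition_trivIset orbit_blocks_partition) _ _.
    exact: imset_f.
  by rewrite !inE eqxx.
rewrite /mate pE; case: pickP => [y|/(_ (f x))] /=.
  by rewrite !inE => /andP[/orP[]/eqP->]; rewrite ?eqxx.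
by rewrite !inE eqxx orbT /= => /negbFE/eqP.
Qed.

End InvolutionBlocks.

Section BaseState.
Variables (n d : nat).

(** The blocks are the singletons. Without arcs, the action of a diagram on this state
    involves no gluing; nevertheless the state generates the cell module. *)
Definition base_pair : {set {set 'I_n}} * {set 'I_n} :=
  (orbit_blocks id, [set i : 'I_n | i < d]).

Lemma base_is_link_state : is_link_state base_pair.
Proof.
apply/andP; split.
  by apply: orbit_blocks_nc_small => //= x y; lia.
apply/forall_inP=> j _; apply/andP; split.
  by apply/imsetP; exists j => //=; rewrite setUid.
apply/forallP => i; apply/forallP => k; apply/implyP => ijk; apply/negP => /imsetP[x _] /setP e.
have := e i; have := e k; rewrite !inE !eqxx !orbT !orbb /=.
by move=> /esym/eqP ek /esym/eqP ei; move: ijk; rewrite ek ei; lia.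
Qed.

Definition base_state : link_state n := Sub base_pair base_is_link_state.

Lemma has_defect_base (C : {set 'I_n + 'I_n}) :
  has_defect base_state C = [exists i : 'I_n, (i < d) && (inr i \in C)].
Proof. by apply: eq_existsb => i; rewrite inE. Qed.

Lemma act_comps_base (q : diagram n) : act_comps q base_state = val q.
Proof.
have partq := diagram_partition q.
apply: components_coarse => //; first exact: subsetUl.
move=> B /setUP[Bq|/imsetP[_ /imsetP[i _ ->] ->]]; first by exists B.
exists (pblock (val q) (inr i)); first exact: pblockT_mem partq _.
apply/subsetP=> x /imsetP[j]; rewrite setUid => /set1P-> ->.
exact: mem_pblockT partq _.
Qed.

(** The blocks of the result are the traces of the blocks of [q] on the upper row,
    which do not cross. A defect is joined to a lower point, so an arc over it would
    cross this connection. *)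
Lemma act_base_is_link_state (q : diagram n) : is_link_state (act_link q base_state).
Proof.
rewrite /act_link act_comps_base.
apply/andP; split => /=.
  apply/and3P; split; first exact: trace_partition (diagram_partition q).
    apply/forall_inP=> _ /setD1P[_ /imsetP[B BP ->]].
    apply/forall_inP=> _ /setD1P[_ /imsetP[C CP ->]].
    apply/implyP=> BC'; have BC : B != C by apply: contraNneq BC' => ->.
    apply/negP; case/exists_inP=> b bB /exists_inP[c cC] /exists_inP[b' b'B] /exists_inP[c' c'C].
    case/andP=> /andP[bc cb' b'c']; rewrite !inE in bB cC b'B c'C.
    exact: (nc_small_uncrossed (valP q) BP CP BC bB cC b'B c'C).
  apply/forall_inP=> _ /setD1P[_ /imsetP[B BP ->]].
  apply: leq_trans (forall_inP (diagram_card2 q) B BP).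
  rewrite -(card_imset _ (@inl_inj 'I_n 'I_n)); apply/subset_leq_card/subsetP.
  by move=> _ /imsetP[i iB ->]; rewrite inE in iB.
apply/forall_inP=> j; rewrite inE => /exists_inP[B BP /andP[/eqP uB hB]].
apply/andP; split.
  rewrite in_setD1; apply/andP; split; last by rewrite -uB imset_f.
  by apply/set0Pn; exists j; rewrite inE.
apply/forallP => i; apply/forallP => k; apply/implyP => /andP[ij jk]; apply/negP.
case/setD1P=> _ /imsetP[C CP uC].
move: hB; rewrite has_defect_base => /existsP[m /andP[_ mB]].
have jB : inl j \in B by have := set11 j; rewrite -uB inE.
have iC : inl i \in C by have := set21 i k; rewrite uC inE.
have kC : inl k \in C by have := set22 i k; rewrite uC inE.
apply: (nc_small_uncrossed (valP q) CP BP _ iC jB kC mB) => //=; last first.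
  by have := ltn_ord k; lia.
apply/eqP => CB; have : i \in upper B by rewrite -CB inE.
by rewrite uB inE => /eqP e; move: ij; rewrite e ltnn.
Qed.

Definition top_state (q : diagram n) : link_state n := Sub _ (act_base_is_link_state q).

Lemma val_top_state (q : diagram n) : val (top_state q) = act_link q base_state.
Proof. by []. Qed.

End BaseState.

(** * Associativity on the link state without arcs *)

Section StackOnBase.
Variables (n d : nat) (p q : diagram n).

Local Notation row3 := ('I_n + 'I_n + 'I_n)%type.
Local Notation pieces := ([set @top_emb n @: (B : {set _}) | B in val p] :|:
              [set @bot_emb n @: (B : {set _}) | B in val q]).
Let w : link_state n := top_state d q.
Let K3 := stack_comps p q.

Definition stack_diagram : diagram n := Sub _ (stack_is_diagram p q).

Lemma stack_class (K : {set row3}) x : K \in K3 -> x \in K -> K = linked_class pieces x.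
Proof. exact: mem_component. Qed.

Lemma blocks_top_state : blocks w = [set upper B | B : {set _} in val q] :\ set0.
Proof. by rewrite /blocks /= act_comps_base. Qed.

Lemma defects_top_state j : (j \in defects w) =
  [exists B in val q, (upper B == [set j]) && has_defect (base_state n d) B].
Proof. by rewrite /defects /= act_comps_base inE. Qed.

Lemma linked_act_stack x y :
  linked (act_edges p w) x y -> linked pieces (inl x) (inl y).
Proof.
move: y; apply: (linked_ind (Q := fun y => linked pieces (inl x) (inl y))).
  exact: linked0.
move=> B y z BE yB zB xy; apply: linked_trans xy _.
case/setUP: BE => [Bp|/imsetP[B']].
  apply: (linked_piece (B := @top_emb n @: B)); [|exact: imset_f|exact: imset_f].
  by apply/setUP; left; apply: imset_f.
rewrite blocks_top_state => /setD1P[_ /imsetP[B'' B''q ->]] EB; move: yB zB.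
rewrite EB => /imsetP[i iB ->] /imsetP[j jB ->]; rewrite !inE in iB jB.
apply: (linked_piece (B := @bot_emb n @: B'')).
- by apply/setUP; right; apply: imset_f.
- exact: (imset_f (@bot_emb n) iB).
- exact: (imset_f (@bot_emb n) jB).
Qed.

(** How a point of the three-row picture is seen from the two upper rows: a lower
    point can only be entered through a block of [q] that joins it to the middle
    row, since the link state below has no arcs. *)
Definition reached (x : 'I_n + 'I_n) (y : row3) : Prop :=
  match y with
  | inl y' => is_true (linked (act_edges p w) x y')
  | inr b => exists m (B : {set 'I_n + 'I_n}),
      [/\ B \in val q, inl m \in B, inr b \in B & linked (act_edges p w) x (inr m)]
  end.

(** Induction along a path in the three-row picture; a passage through a block of [q]
    is replaced by a passage through the trace of this block on the middle row. *)
Lemma linked_stack_act x y : linked pieces (inl x) y -> reached x y.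
Proof.
move: y; apply: linked_ind; first exact: linked0.
have tI := partition_trivIset (diagram_partition q).
have up (B : {set _}) i j : B \in val q -> inl i \in B -> inl j \in B ->
    linked (act_edges p w) (inr i) (inr j).
  move=> Bq iB jB; apply: (linked_piece (B := inr @: upper B)).
  - apply/setUP; right; apply: imset_f; rewrite blocks_top_state in_setD1 imset_f // andbT.
    by apply/set0Pn; exists i; rewrite inE.
  - by apply: imset_f; rewrite inE.
  - by apply: imset_f; rewrite inE.
move=> _ _ _ /setUP[]/imsetP[B Bp ->] /imsetP[y yB ->] /imsetP[z zB ->] /=.
  move=> xy; apply: linked_trans xy _; apply: (linked_piece (B := B)) => //.
  by apply/setUP; left.
case: y yB => [i|b] yB /= xy.
  case: z zB => [j|b] zB /=; first exact: linked_trans xy (up _ _ _ Bp yB zB).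
  by exists i, B.
case: xy => m [B' [B'q mB' bB' xm]].
have eB : B' = B by rewrite -(def_pblock tI Bp yB) (def_pblock tI B'q bB').
rewrite {}eB in mB' bB' B'q.
case: z zB => [j|c] zB /=; first exact: linked_trans xm (up _ _ _ Bp mB' zB).
by exists m, B.
Qed.

Lemma top_linked_class x :
  @top_emb n @^-1: linked_class pieces (inl x) = linked_class (act_edges p w) x.
Proof.
apply/setP=> y; rewrite !inE; apply/idP/idP => [/linked_stack_act //|].
exact: linked_act_stack.
Qed.

(** The components for [p] acting on [q] acting on the base state are the traces
    on the two upper rows of the components of [p] above [q]. *)
Lemma act_comps_trace :
  act_comps p w = [set @top_emb n @^-1: (K : {set row3}) | K in K3] :\ set0.
Proof.
apply/setP=> C; apply/linked_classP/setD1P => [[x ->]|[/set0Pn[x xC] /imsetP[K KK CE]]].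
  split; first by apply/set0Pn; exists x; apply: mem_class.
  by rewrite -top_linked_class; apply: imset_f; apply: class_component.
have xK : inl x \in K by move: xC; rewrite CE inE.
by exists x; rewrite -top_linked_class -(stack_class KK xK).
Qed.

(** The components that the previous trace loses: those inside the lower row. They
    are already deleted when [q] acts on the base state. *)
Lemma bottom_comps :
  [set K in K3 | @top_emb n @^-1: (K : {set row3}) == set0] =
  [set @bot_emb n @: (B : {set _}) | B in [set B in val q | upper B == set0]].
Proof.
have tI := partition_trivIset (diagram_partition q).
have main (B : {set 'I_n + 'I_n}) b : B \in val q -> upper B = set0 -> inr b \in B ->
    linked_class pieces (bot_emb (inr b)) = @bot_emb n @: B.
  move=> Bq uB bB; apply/setP=> z; rewrite inE; apply/idP/idP => [|/imsetP[y yB ->]]; last first.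
    apply: (linked_piece (B := @bot_emb n @: B)); [|exact: imset_f|exact: imset_f].
    by apply/setUP; right; apply: imset_f.
  move: z; apply: linked_ind; first exact: imset_f.
  move=> _ _ _ /setUP[]/imsetP[B' B'p ->] /imsetP[y yB ->] /imsetP[z zB ->].
    case/imsetP=> -[i|//] iB _; have : i \in upper B by rewrite inE.
    by rewrite uB inE.
  rewrite (mem_imset _ _ (@bot_emb_inj n)) => yB'.
  have eB : B' = B by rewrite -(def_pblock tI B'p yB) (def_pblock tI Bq yB').
  by apply: imset_f; rewrite -eB.
have ex (B : {set 'I_n + 'I_n}) : B \in val q -> upper B = set0 -> exists b, inr b \in B.
  move=> Bq uB; have /set0Pn[[i iB|b bB]] : B != set0.
  - by apply: contraTneq Bq => ->; have /and3P[] := diagram_partition q.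
  - have : i \in upper B by rewrite inE.
    by rewrite uB inE.
  - by exists b.
apply/setP=> K; rewrite inE; apply/andP/imsetP => [[KK /eqP K0]|[B]]; last first.
  rewrite inE => /andP[Bq /eqP uB] ->; have [b bB] := ex _ Bq uB.
  rewrite -(main _ _ Bq uB bB); split; first exact: class_component.
  rewrite (main _ _ Bq uB bB); apply/eqP/setP=> y; rewrite !inE; apply/negP.
  case/imsetP=> -[i|//] iB _; have : i \in upper B by rewrite inE.
  by rewrite uB inE.
have /linked_classP[x Kx] := KK.
have xK : x \in K by rewrite Kx mem_class.
case: x xK Kx => [x|b] xK Kx.
  have : x \in @top_emb n @^-1: K by rewrite inE.
  by rewrite K0 inE.
pose B := pblock (val q) (inr b).
have Bq : B \in val q := pblockT_mem (diagram_partition q) _.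
have bB : inr b \in B := mem_pblockT (diagram_partition q) _.
have uB : upper B = set0.
  apply/setP=> i; rewrite !inE; apply/negP => iB.
  have : inr i \in @top_emb n @^-1: K; last by rewrite K0 inE.
  rewrite inE Kx inE; apply: (linked_piece (B := @bot_emb n @: B)).
  - by apply/setUP; right; apply: imset_f.
  - exact: (imset_f (@bot_emb n) bB).
  - exact: (imset_f (@bot_emb n) iB).
by exists B; rewrite ?inE ?Bq ?uB ?eqxx // Kx; apply: main.
Qed.

(** The components that carry a defect of the base state. *)
Definition touches_base (K : {set row3}) : bool :=
  [exists i : 'I_n, (i < d) && (inr i \in K)].

Definition top_row (K : {set row3}) : {set 'I_n} := [set i | inl (inl i) \in K].

Lemma has_defect_outer (K : {set row3}) :
  has_defect (base_state n d) (@outer_emb n @^-1: K) = touches_base K.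
Proof. by rewrite has_defect_base; apply: eq_existsb => i; rewrite inE. Qed.

Lemma has_defect_top (K : {set row3}) : K \in K3 -> @top_emb n @^-1: K != set0 ->
  has_defect w (@top_emb n @^-1: K) = touches_base K.
Proof.
move=> KK /set0Pn[x]; rewrite inE => xK.
apply/exists_inP/existsP => [[j]|[i /andP[id iK]]].
  rewrite defects_top_state inE => /exists_inP[B Bq /andP[/eqP uB]].
  rewrite has_defect_base => /existsP[i /andP[id iB]] jK; exists i; rewrite id.
  have jB : inl j \in B by have := set11 j; rewrite -uB inE.
  rewrite (stack_class KK jK) inE; apply: (linked_piece (B := @bot_emb n @: B)).
  - by apply/setUP; right; apply: imset_f.
  - exact: (imset_f (@bot_emb n) jB).
  - exact: (imset_f (@bot_emb n) iB).
have := iK; rewrite (stack_class KK xK) inE => /linked_stack_act[m [B [Bq mB iB xm]]].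
exists m; last by rewrite !inE; apply: linked_act_stack.
rewrite defects_top_state; apply/exists_inP; exists B => //.
rewrite has_defect_base; apply/andP; split; last by apply/existsP; exists i; rewrite id.
have EB : B = [set inl m; inr i].
  apply/esym/eqP; rewrite eqEcard cards2 /= (forall_inP (diagram_card2 q)) // andbT.
  by apply/subsetP=> z; rewrite !inE => /orP[]/eqP->.
by apply/eqP/setP=> j; rewrite EB !inE orbF.
Qed.

Section Trace.
Variables (f : 'I_n + 'I_n -> row3) (hd : {set 'I_n + 'I_n} -> bool).
Hypothesis f_inl : forall i, f (inl i) = inl (inl i).
Hypothesis hdE : forall K, K \in K3 -> f @^-1: K != set0 ->
  hd (f @^-1: K) = touches_base K.

Let F := [set f @^-1: (K : {set row3}) | K in K3] :\ set0.

Let upper_trace (K : {set row3}) : upper (f @^-1: K) = top_row K.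
Proof. by apply/setP=> i; rewrite !inE f_inl. Qed.

(** Both sides of the associativity law are link states read off a family of traces
    [f @^-1: K] of the components: the outer trace on one side, the trace on the two
    upper rows on the other. The result depends only on the upper row and on the
    defects below, so it is the same for both. *)
Lemma trace_link :
  ([set upper C | C in F] :\ set0,
   [set j | [exists C in F, (upper C == [set j]) && hd C]]) =
  ([set top_row K | K in K3] :\ set0,
   [set j | [exists K in K3, (top_row K == [set j]) && touches_base K]]).
Proof.
have trace0 (K : {set row3}) : f @^-1: K = set0 -> top_row K = set0.
  by rewrite -upper_trace => ->; apply/setP=> i; rewrite !inE.
have traceF (K : {set row3}) : K \in K3 -> top_row K != set0 ->
    f @^-1: K \in F /\ f @^-1: K != set0.
  move=> KK K0; have nz : f @^-1: K != set0.
    by apply: contraNneq K0 => /trace0->.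
  by rewrite in_setD1 nz imset_f.
congr pair; apply/setP=> A.
  rewrite !in_setD1; apply: andb_id2l => A0.
  apply/imsetP/imsetP => [[C /setD1P[_ /imsetP[K KK ->]] ->]|[K KK AE]].
    by exists K.
  by exists (f @^-1: K); rewrite ?upper_trace //; case: (traceF K KK); rewrite -?AE.
rewrite !inE; apply/exists_inP/exists_inP => [[C /setD1P[K0 /imsetP[K KK EK]]]|[K KK]].
  by rewrite EK upper_trace hdE // -?EK // => h; exists K.
case/andP=> /eqP uK tK.
have [|KF K0] := traceF K KK; first by rewrite uK; apply/set0Pn; exists A; apply: set11.
by exists (f @^-1: K); rewrite // upper_trace uK eqxx hdE.
Qed.

(** A component with nonempty trace is determined by it, so loops may be counted
    in the three-row picture. *)
Lemma trace_loops :
  #|[set C in F | (upper C == set0) && ~~ hd C]| =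
  #|[set K in K3 | [&& f @^-1: (K : {set row3}) != set0, top_row K == set0 & ~~ touches_base K]]|.
Proof.
set S := [set K in K3 | _]; rewrite -[RHS](card_in_imset (f := fun K : {set row3} => f @^-1: K)).
  congr #|pred_of_set _|; apply/setP=> C; apply/idP/imsetP => [|[K]].
    rewrite in_set => /andP[/setD1P[C0 /imsetP[K KK CE]]].
    rewrite CE upper_trace hdE -?CE // => h; exists K => //.
    by rewrite /S inE KK -CE C0.
  move=> KS ->; have /andP[KK /and3P[K0 uK tK]] : (K \in K3) &&
    [&& f @^-1: K != set0, top_row K == set0 & ~~ touches_base K] by move: KS; rewrite inE.
  by rewrite in_set in_setD1 K0 imset_f // upper_trace uK hdE.
move=> K L; rewrite /S !inE => /andP[KK /and3P[/set0Pn[x xK] _ _]] /andP[LK _] e.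
have xL := xK; rewrite e in xL; rewrite !inE in xK xL.
by rewrite (stack_class KK xK) (stack_class LK xL).
Qed.

End Trace.

Lemma act_link_stack :
  act_link stack_diagram (base_state n d) = act_link p w.
Proof.
rewrite /act_link act_comps_base act_comps_trace /= /stack_blocks.
rewrite (@trace_link (@outer_emb n)) //; last by move=> K _ _; apply: has_defect_outer.
by rewrite (@trace_link (@top_emb n)) //; apply: has_defect_top.
Qed.

(** Both sides count the components without upper point and without defect. On the
    left they are split by whether they meet the outer rows, on the right by whether
    they meet the two upper rows. *)
Lemma act_loops_stack :
  stack_loops p q + act_loops stack_diagram (base_state n d) =
  act_loops q (base_state n d) + act_loops p w.
Proof.
rewrite /act_loops !act_comps_base act_comps_trace /= /stack_blocks.
rewrite (@trace_loops (@outer_emb n)) //; last by move=> K _ _; apply: has_defect_outer.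
rewrite (@trace_loops (@top_emb n)) //; last exact: has_defect_top.
pose closed := [set K in K3 | (top_row K == set0) && ~~ touches_base K].
have cardE (Q : pred {set row3}) : #|closed| = #|closed :&: [set K | Q K]| +
    #|[set K in K3 | [&& ~~ Q K, top_row K == set0 & ~~ touches_base K]]|.
  rewrite -(cardsID [set K | Q K] closed); congr addn; congr #|pred_of_set _|.
  by apply/setP=> K; rewrite !inE; case: (Q K); rewrite ?andbF ?andbT.
transitivity #|closed|.
  rewrite [RHS](cardE (fun K => @outer_emb n @^-1: K == set0)); congr addn.
  congr #|pred_of_set _|; apply/setP=> K; rewrite !inE.
  apply/andP/andP => [[KK /eqP K0]|[/andP[]//]]; rewrite KK K0 eqxx /=.
  split=> //; apply/andP; split.
    apply/eqP/setP=> i; have : inl i \notin @outer_emb n @^-1: K by rewrite K0 inE.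
    by rewrite !inE => /negbTE.
  apply/existsPn => i; have : inr i \notin @outer_emb n @^-1: K by rewrite K0 inE.
  by rewrite !inE negb_and => ->; rewrite orbT.
rewrite (cardE (fun K => @top_emb n @^-1: K == set0)); congr addn.
rewrite -(card_imset _ (imset_inj (@bot_emb_inj n))).
congr #|pred_of_set _|; apply/setP=> K.
have KE : (K \in [set @bot_emb n @: (B : {set _}) | B in [set B in val q | upper B == set0]]) =
    (K \in K3) && (@top_emb n @^-1: K == set0) by rewrite -bottom_comps inE.
rewrite !inE.
have tb (B : {set 'I_n + 'I_n}) : touches_base (@bot_emb n @: B) = has_defect (base_state n d) B.
  rewrite has_defect_base; apply: eq_existsb => i; congr andb.
  exact: (mem_imset B (inr i) (@bot_emb_inj n)).
apply/idP/imsetP => [/andP[/and3P[KK uK tK] K0]|[B]].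
  move: KE; rewrite KK K0 /= => /imsetP[B]; rewrite inE => /andP[Bq uB] EB.
  by exists B => //; rewrite inE Bq uB -tb -EB.
rewrite inE => /andP[Bq /andP[uB hB]] EB.
have : K \in [set @bot_emb n @: (B : {set _}) | B in [set B in val q | upper B == set0]].
  by rewrite EB imset_f // inE Bq.
rewrite KE => /andP[KK K0]; rewrite KK K0 EB tb hB !andbT -EB /=.
apply/eqP/setP=> i; rewrite !inE; move/eqP/setP/(_ (inl i)): K0.
by rewrite !inE.
Qed.

End StackOnBase.

(** * Diagrams with a given link state on top *)

Section LinkMate.
Variables (n : nat) (w : link_state n).

Lemma blocks_nc_small : nc_small (@nat_of_ord n) (blocks w).
Proof. by have /andP[] := valP w. Qed.

Lemma blocks_partition : partition (blocks w) [set: 'I_n].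
Proof. by have /and3P[] := blocks_nc_small. Qed.

Lemma blocks_card2 : [forall B in blocks w, #|B| <= 2].
Proof. by have /and3P[] := blocks_nc_small. Qed.

Definition lmate : 'I_n -> 'I_n := mate (blocks w).

Lemma lmateK : involutive lmate.
Proof. exact: mateK blocks_partition blocks_card2. Qed.

Lemma lmate_block i : [set i; lmate i] \in blocks w.
Proof. exact: mate_block blocks_partition blocks_card2 i. Qed.

Lemma lmate_blockE (B : {set 'I_n}) i : i \in B -> (B \in blocks w) = (B == [set i; lmate i]).
Proof. exact: mate_blockE blocks_partition blocks_card2 _ _. Qed.

Lemma lmate_defect i : i \in defects w -> lmate i = i.
Proof.
move=> iD; have /andP[_ /forall_inP/(_ i iD)/andP[iB _]] := valP w.
move: iB; rewrite -/(blocks w) (lmate_blockE (set11 i)) => /eqP e.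
by apply/set1P; rewrite e !inE eqxx orbT.
Qed.

Lemma lmate_defectF i : (lmate i \in defects w) = (i \in defects w).
Proof.
apply/idP/idP => h; last by rewrite lmate_defect.
by have := lmate_defect h; rewrite lmateK => ->.
Qed.

Lemma defect_uncovered (i j : 'I_n) : i < j < lmate i -> j \notin defects w.
Proof.
move=> ij; apply/negP=> jD; have /andP[_ /forall_inP/(_ j jD)/andP[_]] := valP w.
by move=> /forallP/(_ i)/forallP/(_ (lmate i)); rewrite ij -/(blocks w) lmate_block.
Qed.

Lemma lmate_nested (i j : 'I_n) : i < j < lmate i -> i < lmate j < lmate i.
Proof.
case/andP=> ij ji; have := noncrossing_mate blocks_nc_small ij ji.
rewrite -/(lmate _) => /andP[h1 h2]; rewrite !ltn_neqAle h1 h2 !andbT.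
apply/andP; split; apply/eqP=> /val_inj e.
  by move: ji; rewrite e lmateK ltnn.
by move: ij; rewrite -(inv_inj lmateK e) ltnn.
Qed.

Let D := enum (defects w).

Lemma enum_defects_sorted : sorted (relpre val ltn) D.
Proof.
rewrite /D /enum_mem; apply: sorted_filter; first by move=> x y z; apply: ltn_trans.
by rewrite -enumT -sorted_map val_enum_ord iota_ltn_sorted.
Qed.

Lemma size_defects_leq : size D <= n.
Proof. by rewrite -cardE -[X in _ <= X]card_ord max_card. Qed.

(** The involution of a diagram that produces [w] from the base state: the arcs
    and proper singletons of [w] on top, the [k]-th defect threaded down to the
    [k]-th lower point, all other lower points singletons. *)
Definition thread (x : 'I_n + 'I_n) : 'I_n + 'I_n :=
  match x with
  | inl i => if i \in defects w then inr (insubd i (index i D)) else inl (lmate i)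
  | inr k => if k < size D then inl (nth k D k) else inr k
  end.

Lemma index_defect i : i \in defects w -> val (insubd i (index i D)) = index i D.
Proof.
move=> iD; rewrite val_insubd ifT //; apply: leq_trans size_defects_leq.
by rewrite index_mem mem_enum.
Qed.

Lemma threadK : involutive thread.
Proof.
case=> [i|k] /=.
  case: ifP => iD /=; last by rewrite lmate_defectF iD lmateK.
  by rewrite index_defect // index_mem mem_enum iD nth_index ?mem_enum.
case: ifP => kD /=; last by rewrite kD.
have : nth k D k \in D by rewrite mem_nth.
rewrite mem_enum => h; rewrite h; congr inr; apply: val_inj.
by rewrite index_defect // index_uniq // enum_uniq.
Qed.

Lemma thread_noncrossing x y : diag_pos x < diag_pos y -> diag_pos y < diag_pos (thread x) ->
  diag_pos x < diag_pos (thread y) < diag_pos (thread x).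
Proof.
(* Threads do not cross as defects are numbered from left to right; no arc
   crosses a thread as defects are not covered by arcs. *)
have trans : transitive (relpre val ltn : rel 'I_n) by move=> a b c; apply: ltn_trans.
case: x => [i|k] /=; last first.
  case: ifP => _ /=; last by lia.
  by have := ltn_ord (nth k D k); case: y => [j|l] /=; have := ltn_ord k; lia.
case: ifP => iD /=; last first.
  case: y => [j|l] /=; last by have := ltn_ord (lmate i); lia.
  move=> ij jm; have ijm : i < j < lmate i by rewrite ij.
  by rewrite (negbTE (defect_uncovered ijm)) /=; apply: lmate_nested.
rewrite index_defect //; case: y => [j|l] /=.
  move=> ij _; case: ifP => jD /=.
    have h : index i D < index j D.
      rewrite ltnNge; apply/negP; rewrite leq_eqVlt => /orP[/eqP e|h].
        have := nth_index i (s := D) (x := j); rewrite mem_enum e nth_index ?mem_enum //.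
        by move=> /(_ jD) e'; move: ij; rewrite e' ltnn.
      have := sorted_ltn_index trans enum_defects_sorted j i; rewrite !mem_enum.
      by move=> /(_ jD iD h) /=; lia.
    have := size_defects_leq; have : index j D < size D by rewrite index_mem mem_enum.
    rewrite index_defect //; have := ltn_ord i; move: h.
    by move: (index i D) (index j D) (size D) => a b c; lia.
  have := ltn_ord (lmate j); suff : i < lmate j by have := ltn_ord i; lia.
  rewrite ltnNge; apply/negP; rewrite leq_eqVlt => /orP[/eqP/val_inj e|h].
    by move: jD; rewrite -lmate_defectF e iD.
  have := @defect_uncovered (lmate j) i; rewrite lmateK h ij => /(_ isT).
  by rewrite iD.
move=> _ il; case: ifP => lD /=.
  2: by move: (index i D) il => a; have := ltn_ord l; have := ltn_ord i; lia.
have jD : nth l D l \in defects w by rewrite -mem_enum mem_nth.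
have h : index i D < l by move: (index i D) il => a; have := ltn_ord l; lia.
have := sorted_ltn_nth trans l enum_defects_sorted; move/(_ (index i D) l).
rewrite !inE index_mem mem_enum => /(_ iD lD h) /=; rewrite nth_index ?mem_enum //.
have := ltn_ord (nth l D l); move: lD (nth l D l) => _; move: (index i D) h => a; lia.
Qed.

Definition thread_diagram : diagram n :=
  Sub (orbit_blocks thread) (orbit_blocks_nc_small threadK thread_noncrossing).

Lemma upper_thread i : upper [set inl i; thread (inl i)] = [set i; lmate i].
Proof.
apply/setP=> j; rewrite !inE /=; case: ifP => iD /=; last by [].
by rewrite lmate_defect // orbF orbb.
Qed.

Lemma thread_block (C : {set 'I_n + 'I_n}) i :
  C \in orbit_blocks thread -> i \in upper C -> C = [set inl i; thread (inl i)].
Proof. by rewrite inE; apply: orbit_blocks_mem threadK _ _. Qed.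

Lemma act_link_thread : act_link thread_diagram (base_state n #|defects w|) = val w.
Proof.
rewrite /act_link act_comps_base /=; rewrite [val w]surjective_pairing.
congr pair.
  apply/setP=> B; apply/setD1P/idP => [[/set0Pn[i iB] /imsetP[C CP BE]]|BP].
    rewrite BE (thread_block CP (i := i)) ?upper_thread -?BE //.
    exact: lmate_block.
  have [i iB] : exists i, i \in B.
    by apply/set0Pn; apply: contraTneq BP => ->; have /and3P[] := blocks_partition.
  have BE : B = [set i; lmate i] by apply/eqP; rewrite -lmate_blockE.
  split; first by apply/set0Pn; exists i.
  by apply/imsetP; exists [set inl i; thread (inl i)]; rewrite ?upper_thread //; apply: imset_f.
apply/setP=> j; rewrite inE; apply/exists_inP/idP => [[C CP /andP[/eqP uC]]|jD].
  rewrite has_defect_base (thread_block CP (i := j)) ?uC ?set11 //.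
  by case/existsP=> k; rewrite !inE /=; case: ifP => //; rewrite andbF.
exists [set inl j; thread (inl j)]; first exact: imset_f.
rewrite upper_thread (lmate_defect jD) setUid eqxx has_defect_base.
apply/existsP; exists (insubd j (index j D)); rewrite !inE /= jD eqxx andbT.
by rewrite index_defect // cardE index_mem mem_enum.
Qed.

End LinkMate.

(** * Words and matchings *)

Local Notation up := (Some true).
Local Notation down := (Some false).
Local Notation flat := (@None bool).

(** Words are read from right to left: the letter at the head of the list is the
    last step. The value is the stack of the unmatched up steps, latest first; a down
    step is matched with the top of the stack, and [matching] records the pairs. *)
Fixpoint unmatched (w : seq (option bool)) : seq nat :=
  match w with
  | [::] => [::]
  | None :: u => unmatched u
  | Some true :: u => size u :: unmatched u
  | Some false :: u => behead (unmatched u)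
  end.

Fixpoint matching (w : seq (option bool)) (i : nat) : nat :=
  match w with
  | [::] => i
  | Some false :: u =>
      let t := head (size u) (unmatched u) in
      if i == size u then t else if i == t then size u else matching u i
  | _ :: u => matching u i
  end.

(** No down step finds an empty stack; see [nonneg_prefixes] for the meaning in
    terms of heights. *)
Fixpoint nonneg (w : seq (option bool)) : bool :=
  if w is x :: u then nonneg u && ((x == down) ==> (unmatched u != [::])) else true.

Definition matching_spec (w : seq (option bool)) : Prop :=
  [/\ [/\ forall i, size w <= i -> matching w i = i,
      forall i, matching w (matching w i) = i
    & forall i j, i < j < matching w i -> i < matching w j < matching w i],
    sorted gtn (unmatched w)
  & forall t, t \in unmatched w -> [/\ t < size w, matching w t = t
                                  & forall i, ~ (i < t < matching w i)]].

Lemma matchingP w : nonneg w -> matching_spec w.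
Proof.
elim: w => [|x u IH] /=; first by split=> //; split=> //= i j; lia.
case/andP=> /IH[[out mK nest] srt inv].
have bnd i : i < size u -> matching u i < size u.
  by move=> iu; rewrite ltnNge; apply/negP => /[dup] h /out; rewrite mK; lia.
case: x => [[]|] /= ne.
- split; [by split=> // i ui; apply: out; apply: ltnW| |].
    rewrite /= path_min_sorted //; apply/allP=> t /inv[]; by [].
  move=> t; rewrite inE => /orP[/eqP->|/inv[tu mt nc]]; last by split=> //; apply: ltnW.
  split; rewrite /= ?out // => i /andP[/= iu ui].
  by have := bnd i; have := out i; lia.
- case E: (unmatched u) ne srt inv => [|t st] //= _ srt inv.
  have [tu mt nc] := inv t (mem_head _ _).
  have st_lt (s : nat) : s \in st -> s < t.
    by move: srt => /(order_path_min (rev_trans ltn_trans)) /allP; apply.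
  rewrite /matching_spec /= E /=.
  (* The top [t] of the stack is uncovered, so that joining it to the new point
     creates no crossing, and the new arc covers no entry below [t]. *)
  pose m i := if i == size u then t else if i == t then size u else matching u i.
  have mE i : i != size u -> i != t -> m i = matching u i.
    by rewrite /m => /negbTE-> /negbTE->.
  have m_size : m (size u) = t by rewrite /m eqxx.
  have m_t : m t = size u by rewrite /m eqxx ltn_eqF.
  have mne i : i != size u -> i != t -> matching u i != size u /\ matching u i != t.
    move=> iu it; split.
      by apply: contra_neq iu => e; rewrite -(mK i) e out.
    by apply: contra_neq it => e; rewrite -(mK i) e mt.
  split; [split| |].
  + by move=> i ui; rewrite -/(m i) mE ?out //; lia.
  + move=> i; rewrite -/(m i) -/(m (m i)).
    have [->|iu] := eqVneq i (size u); first by rewrite m_size m_t.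
    have [->|it] := eqVneq i t; first by rewrite m_t m_size.
    by have [h1 h2] := mne i iu it; rewrite (mE i) // mE // mK.
  + move=> i j; rewrite -/(m i) -/(m j).
    have [->|iu] := eqVneq i (size u); first by rewrite m_size; lia.
    have [->|it] := eqVneq i t.
      rewrite m_t => /andP[tj ju]; have jt : j != t by lia.
      have ju' : j != size u by lia.
      have [/eqP h1 /eqP h2] := mne j ju' jt; rewrite mE //.
      by have := bnd j ju; have := nc (matching u j); rewrite mK; lia.
    rewrite (mE i) // => ij.
    have jt : j != t by apply/eqP=> jt; apply: (nc i); rewrite -jt.
    have ju : j != size u.
      by apply/eqP=> ju; have := bnd i; have := out i; lia.
    by rewrite mE //; apply: nest.
  + exact: path_sorted srt.
  move=> s sst; have st' := st_lt s sst.
  have [su ms nc'] := inv s (mem_behead (s := t :: st) sst).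
  split; first exact: ltnW.
    by rewrite -/(m s) mE //; lia.
  move=> i; rewrite -/(m i).
  have [->|iu] := eqVneq i (size u); first by rewrite m_size; lia.
  have [->|it] := eqVneq i t; first by lia.
  by rewrite mE.
split; [by split=> // i ui; apply: out; apply: ltnW|exact: srt|].
by move=> t /inv[tu mt nc]; split=> //; apply: ltnW.
Qed.

(** The letter of position [i] in a link state with mates [m] and defects [D]. Defects
    and left ends of arcs are both up steps: the former are those never matched. *)
Definition letter (m : nat -> nat) (D : pred nat) (i : nat) : option bool :=
  if D i || (i < m i) then up else if m i < i then down else flat.

Lemma letter_matching w i : nonneg w -> i < size w ->
  letter (matching w) [in unmatched w] i = nth flat (rev w) i.
Proof.
elim: w => //= x u IH /andP[nu ne]; rewrite ltnS rev_cons nth_rcons size_rev => iu.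
have [[out mK nest] srt inv] := matchingP nu.
have notin : (size u \in unmatched u) = false.
  by apply/negP => /inv[]; rewrite ltnn.
have [lt|ge] := ltnP i (size u).
  rewrite -IH //; case: x ne => [[]|] //= ne; rewrite /letter /=.
    by rewrite inE ltn_eqF.
  case E: (unmatched u) ne srt inv => [|t st] //= _ srt inv.
  have [tu mt nc] := inv t (mem_head _ _).
  rewrite (ltn_eqF lt); have [->|it] := eqVneq i t.
    by rewrite tu mem_head orbT.
  by rewrite inE (negbTE it).
have -> : i = size u by lia.
rewrite eqxx; case: x ne => [[]|] //= ne; rewrite /letter /= ?inE ?eqxx //.
  case E: (unmatched u) ne srt inv => [|t st] //= _ srt inv.
  have [tu mt nc] := inv t (mem_head _ _).
  have -> : (size u \in st) = false.
    by apply/negP=> h; have [] := inv (size u) (mem_behead (s := t :: st) h); rewrite ltnn.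
  by rewrite tu ltnNge (ltnW tu).
by rewrite notin out // ltnn.
Qed.

(** * Link states as words *)

Lemma letter_eq m m' (D D' : pred nat) i : m i = m' i -> D i = D' i ->
  letter m D i = letter m' D' i.
Proof. by rewrite /letter => -> ->. Qed.

Section Reading.
Variables (n : nat) (v : link_state n).

Definition lmate_nat (i : nat) : nat :=
  if insub i is Some o then nat_of_ord (lmate v o) else i.

Definition defect_nat (i : nat) : bool :=
  if insub i is Some o then o \in defects v else false.

Lemma lmate_natE (i : 'I_n) : lmate_nat i = lmate v i.
Proof. by rewrite /lmate_nat valK. Qed.

Lemma defect_natE (i : 'I_n) : defect_nat i = (i \in defects v).
Proof. by rewrite /defect_nat valK. Qed.

Definition reading k := [seq letter lmate_nat defect_nat i | i <- rev (iota 0 k)].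

Lemma readingS k : reading k.+1 = letter lmate_nat defect_nat k :: reading k.
Proof. by rewrite /reading -addn1 iotaD rev_cat. Qed.

Lemma size_reading k : size (reading k) = k.
Proof. by rewrite size_map size_rev size_iota. Qed.

Definition still_open k i := defect_nat i || (k <= lmate_nat i).

(** After [k] letters the stack holds the points before [k] that are defects or
    whose mate is at [k] or later. If the point [k] closes an arc, its mate is the last
    such point, as the points in between are nested in the arc. *)
Lemma reading_spec k : k <= n ->
  [/\ nonneg (reading k),
      unmatched (reading k) = rev [seq i <- iota 0 k | still_open k i]
    & forall i, i < k ->
        matching (reading k) i = if lmate_nat i < k then lmate_nat i else i].
Proof.
have lt i : i < n -> lmate_nat i < n.
  by move=> h; rewrite -[ i]/(val (Ordinal h)) lmate_natE.
have lK i : i < n -> lmate_nat (lmate_nat i) = i.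
  by move=> h; rewrite -[ i]/(val (Ordinal h)) !lmate_natE lmateK.
have fixd i : i < n -> defect_nat i -> lmate_nat i = i.
  by move=> h; rewrite -[ i]/(val (Ordinal h)) lmate_natE defect_natE => /lmate_defect->.
have nest i j : i < n -> i < j < lmate_nat i -> i < lmate_nat j < lmate_nat i.
  move=> h ij; have hj : j < n by have := lt i h; lia.
  move: ij; rewrite -[ i]/(val (Ordinal h)) -[j]/(val (Ordinal hj)) !lmate_natE.
  exact: lmate_nested.
have uncov i j : i < n -> i < j < lmate_nat i -> defect_nat j = false.
  move=> h ij; have hj : j < n by have := lt i h; lia.
  move: ij; rewrite -[ i]/(val (Ordinal h)) -[j]/(val (Ordinal hj)) lmate_natE defect_natE.
  by move=> /defect_uncovered /negbTE.
elim: k => [|k IH] kn; first by split.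
have [nk uk mk] := IH (ltnW kn); rewrite readingS /letter.
have open_eq i : lmate_nat i != k -> still_open k.+1 i = still_open k i.
  by move=> ik; rewrite /still_open [in RHS]leq_eqVlt eq_sym (negbTE ik).
have iota_k : iota 0 k.+1 = rcons (iota 0 k) k by rewrite -addn1 iotaD cats1.
rewrite iota_k.
(* The point [k] opens an arc, closes one, or is a singleton. *)
have [mkk|kk|mkk] := ltngtP k (lmate_nat k).
- rewrite orbT /= size_reading nk; split=> //.
    have sk : still_open k.+1 k by rewrite /still_open mkk orbT.
    rewrite filter_rcons sk rev_rcons uk; congr (_ :: rev _).
    apply: eq_in_filter => i; rewrite mem_iota add0n => /andP[_ ik]; apply/esym/open_eq.
    by apply/eqP=> e; have := lK i; rewrite e; lia.
  move=> i; rewrite ltnS leq_eqVlt => /orP[/eqP->|ik].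
    by have [[out _ _] _ _] := matchingP nk; rewrite out ?size_reading // ltnNge mkk.
  rewrite mk //; have ne : lmate_nat i <> k by move=> e; have := lK i; rewrite e; lia.
  by congr (if _ then _ else _); lia.
- set t := lmate_nat k in kk *.
  have tn : t < n by lia.
  have mt : lmate_nat t = k by rewrite lK.
  have dk : defect_nat k = false by apply/negP => /(fixd k kn); lia.
  have dt : defect_nat t = false by apply/negP => /(fixd t tn); lia.
  rewrite dk /= nk; set os := [seq i <- iota 0 t | still_open k i].
  have uE : unmatched (reading k) = t :: rev os.
    rewrite uk -rev_rcons; congr rev.
    have -> : iota 0 k = iota 0 t ++ t :: iota t.+1 (k - t.+1).
      have {1}-> : k = t + (k - t.+1).+1 by lia.
      by rewrite iotaD add0n.
    have sk : still_open k t by rewrite /still_open mt leqnn orbT.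
    rewrite filter_cat /= sk -cats1; congr (_ ++ _ :: _).
    rewrite (eq_in_filter (a2 := pred0)) ?filter_pred0 // => i; rewrite mem_iota => ti.
    have tik : t < i < lmate_nat t by rewrite mt; lia.
    by have := nest _ _ tn tik; rewrite /still_open (uncov _ _ tn tik) mt /=; lia.
  have open_step i : i < k -> still_open k.+1 i = still_open k i && (i != t).
    move=> ik; have [->|it] := eqVneq i t; first by rewrite /still_open dt mt andbF ltnn.
    by rewrite andbT; apply: open_eq; apply: contra_neq it => e; rewrite -(lK i) ?e //; lia.
  rewrite uE /=; split=> //.
    have -> : [seq i <- rcons (iota 0 k) k | still_open k.+1 i] = [seq i <- iota 0 k | still_open k.+1 i].
      by rewrite filter_rcons /still_open dk /= ltnNge (ltnW kk).
    congr rev; have -> : iota 0 k = iota 0 t ++ t :: iota t.+1 (k - t.+1).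
      have {1}-> : k = t + (k - t.+1).+1 by lia.
      by rewrite iotaD add0n.
    have sk : still_open k.+1 t = false by rewrite /still_open dt mt ltnn.
    rewrite filter_cat /= sk.
    rewrite [X in _ ++ X](eq_in_filter (a2 := pred0)) ?filter_pred0 ?cats0.
      apply: eq_in_filter => i; rewrite mem_iota => it; rewrite open_step; last by lia.
      have -> : i != t by lia.
      by rewrite andbT.
    move=> i; rewrite mem_iota => ti.
    have tik : t < i < lmate_nat t by rewrite mt; lia.
    by have := nest _ _ tn tik; rewrite /still_open (uncov _ _ tn tik) mt /=; lia.
  rewrite size_reading => i; rewrite ltnS leq_eqVlt => /orP[/eqP->|ik].
    by rewrite eqxx -/t ltnS (ltnW kk).
  rewrite (ltn_eqF ik); have [->|it] := eqVneq i t; first by rewrite mt leqnn.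
  rewrite mk //; have ne : lmate_nat i <> k.
    by move=> e; move/eqP: it; apply; rewrite -(lK i) ?e //; lia.
  by congr (if _ then _ else _); lia.
have [dk|dk] := boolP (defect_nat k); rewrite /= ?size_reading nk /=.
  split=> //.
    have sk : still_open k.+1 k by rewrite /still_open dk.
    rewrite filter_rcons sk rev_rcons uk; congr (_ :: rev _).
    apply: eq_in_filter => i; rewrite mem_iota add0n => /andP[_ ik]; apply/esym/open_eq.
    by apply/eqP=> e; have := lK i; rewrite e -mkk; lia.
  move=> i; rewrite ltnS leq_eqVlt => /orP[/eqP->|ik].
    by have [[out _ _] _ _] := matchingP nk; rewrite out ?size_reading // -mkk if_same.
  rewrite mk //; have ne : lmate_nat i <> k by move=> e; have := lK i; rewrite e -mkk; lia.
  by congr (if _ then _ else _); lia.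
split=> //.
  have sk : still_open k.+1 k = false by rewrite /still_open (negbTE dk) -mkk ltnn.
  rewrite filter_rcons sk uk; congr rev.
  apply: eq_in_filter => i; rewrite mem_iota add0n => /andP[_ ik]; apply/esym/open_eq.
  by apply/eqP=> e; have := lK i; rewrite e -mkk; lia.
move=> i; rewrite ltnS leq_eqVlt => /orP[/eqP->|ik].
  by have [[out _ _] _ _] := matchingP nk; rewrite out ?size_reading // -mkk if_same.
rewrite mk //; have ne : lmate_nat i <> k by move=> e; have := lK i; rewrite e -mkk; lia.
by congr (if _ then _ else _); lia.
Qed.

End Reading.

(** * Counting link states *)

Section LinkWord.
Variable n : nat.

Lemma link_state_eq (v v' : link_state n) :
  lmate v =1 lmate v' -> defects v = defects v' -> v = v'.
Proof.
move=> em ed; apply: val_inj; rewrite [val v]surjective_pairing [RHS]surjective_pairing.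
congr pair; last exact: ed.
have sub (x y : link_state n) (B : {set 'I_n}) : lmate x =1 lmate y -> B \in blocks x -> B \in blocks y.
  move=> e Bx; have [i iB] : exists i, i \in B.
    by apply/set0Pn; apply: contraTneq Bx => ->; have /and3P[] := blocks_partition x.
  by move: Bx; rewrite (lmate_blockE x iB) (lmate_blockE y iB) e.
by apply/setP=> B; apply/idP/idP; apply: sub => // i; rewrite em.
Qed.

Lemma unmatched_reading (v : link_state n) :
  unmatched (reading v n) = rev [seq i <- iota 0 n | defect_nat v i].
Proof.
have [_ -> _] := reading_spec v (leqnn n); congr rev.
apply: eq_in_filter => i; rewrite mem_iota add0n => /andP[_ h].
by rewrite /still_open -[ i]/(val (Ordinal h)) lmate_natE leqNgt ltn_ord orbF.
Qed.

Lemma matching_reading (v : link_state n) (i : 'I_n) :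
  matching (reading v n) i = lmate v i.
Proof.
have [_ _ ->] := reading_spec v (leqnn n); last exact: ltn_ord.
by rewrite lmate_natE ltn_ord.
Qed.

Lemma size_unmatched_reading (v : link_state n) :
  size (unmatched (reading v n)) = #|defects v|.
Proof.
rewrite unmatched_reading size_rev size_filter -val_enum_ord count_map -sum1_count.
rewrite big_enum_cond -sum1_card; apply: eq_bigl => i.
exact: (defect_natE v i).
Qed.

Lemma reading_inj (v v' : link_state n) : reading v n = reading v' n -> v = v'.
Proof.
move=> e; apply: link_state_eq => [i|].
  by apply: val_inj; rewrite /= -!matching_reading e.
apply/setP=> i; rewrite -!defect_natE.
have main (x : link_state n) : defect_nat x i = (val i \in unmatched (reading x n)).
  by rewrite unmatched_reading mem_rev mem_filter mem_iota /= add0n ltn_ord andbT.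
by rewrite !main e.
Qed.

Section FromWord.
Variables (w : seq (option bool)).
Hypotheses (nw : nonneg w) (sw : size w = n).

Definition word_mate (i : 'I_n) : 'I_n := insubd i (matching w i).

Lemma word_mateE (i : 'I_n) : nat_of_ord (word_mate i) = matching w i.
Proof.
have [[out mK _] _ _] := matchingP nw.
rewrite val_insubd ifT // ltnNge; apply/negP => /[dup] h; rewrite -{1}sw => /out.
by rewrite mK => e; move: h; rewrite -e leqNgt ltn_ord.
Qed.

Lemma word_mateK : involutive word_mate.
Proof.
move=> i; apply: val_inj; rewrite /= !word_mateE.
by have [[_ -> _] _ _] := matchingP nw.
Qed.

Definition word_pair : {set {set 'I_n}} * {set 'I_n} :=
  (orbit_blocks word_mate, [set i : 'I_n | val i \in unmatched w]).

Lemma word_is_link_state : is_link_state word_pair.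
Proof.
have [[out mK nest] _ inv] := matchingP nw.
apply/andP; split.
  apply: (orbit_blocks_nc_small word_mateK) => i j; rewrite !word_mateE => ij jm.
  by apply: nest; rewrite ij.
apply/forall_inP=> j; rewrite inE => /inv[_ mj nc]; apply/andP; split.
  apply/imsetP; exists j => //; have -> : word_mate j = j by apply: val_inj; rewrite /= word_mateE.
  by rewrite setUid.
apply/forallP=> i; apply/forallP=> k; apply/implyP=> /andP[ij jk]; apply/negP => B.
have := orbit_blocks_mem word_mateK B (set21 i k) => /setP/(_ k).
rewrite !inE eqxx orbT => /esym/orP[]/eqP e.
  by move: ij jk; rewrite e; lia.
by apply: (nc i); rewrite -word_mateE -e ij.
Qed.

Definition word_state : link_state n := Sub word_pair word_is_link_state.

Lemma reading_word_state : reading word_state n = w.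
Proof.
rewrite /reading map_rev -[RHS]revK; congr rev.
apply: (@eq_from_nth _ flat); first by rewrite size_map size_iota size_rev.
move=> i; rewrite size_map size_iota => h.
rewrite (nth_map 0) ?size_iota // nth_iota // add0n -letter_matching ?sw //.
apply: letter_eq; rewrite -[ i]/(val (Ordinal h)).
  rewrite lmate_natE -word_mateE; congr nat_of_ord.
  exact: (mate_orbit_blocks word_mateK).
by rewrite defect_natE inE.
Qed.

End FromWord.

Definition height_words d :=
  [set w : n.-tuple (option bool) | nonneg w && (size (unmatched w) == d)].

(** Reading a link state letter by letter is a bijection onto the words that stay
    nonnegative, and the defects are the up steps left on the stack. *)
Lemma card_link_states d :
  #|[set v : link_state n | #|defects v| == d]| = #|height_words d|.
Proof.
pose word (v : link_state n) : n.-tuple (option bool) :=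
  Tuple (introT eqP (size_reading v n)).
have word_inj : injective word by move=> v v' [] /reading_inj.
rewrite -(card_imset _ word_inj); congr #|pred_of_set _|; apply/setP=> w.
rewrite inE; apply/imsetP/andP => [[v]|[nw uw]].
  rewrite inE => /eqP vd ->; rewrite /= size_unmatched_reading vd eqxx.
  by have [-> _ _] := reading_spec v (leqnn n).
exists (word_state nw (size_tuple w)).
  by rewrite inE -size_unmatched_reading reading_word_state.
by apply: val_inj; rewrite /= reading_word_state.
Qed.

End LinkWord.

Lemma card_tuple_cons (T : finType) n (A : pred (seq T)) :
  #|[set w : n.+1.-tuple T | A w]| = \sum_(x : T) #|[set w : n.-tuple T | A (x :: w)]|.
Proof.
rewrite -sum1_card (eq_bigl (fun w : n.+1.-tuple T => A w)) => [|w]; last by rewrite inE.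
have bij : bijective (fun p : T * n.-tuple T => cons_tuple p.1 p.2).
  exists (fun w : n.+1.-tuple T => (thead w, [tuple of behead w])).
    by case=> x w /=; congr pair; apply: val_inj.
  by move=> w /=; apply: val_inj; rewrite /= [in RHS](tuple_eta w).
rewrite (reindex _ (onW_bij _ bij)) /=.
rewrite (eq_bigl (fun p : T * n.-tuple T => true && A (p.1 :: p.2))) //.
rewrite -(pair_big_dep xpredT (fun x (w : n.-tuple T) => A (x :: w)) (fun _ _ => 1)) /=.
by apply: eq_bigr => x _; rewrite -sum1_card; apply: eq_bigl => w; rewrite inE.
Qed.

Lemma card_height_words0 d : #|height_words 0 d| = (d == 0).
Proof.
have [->|d0] := eqVneq d 0.
  have -> : height_words 0 0 = [set [tuple]].
    by apply/setP=> w; rewrite !inE (tuple0 w) eqxx.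
  by rewrite cards1.
apply/eqP; rewrite cards_eq0; apply/eqP/setP=> w; rewrite !inE (tuple0 w) /=.
by rewrite eq_sym (negbTE d0).
Qed.

(** The last step comes from the same height, from the height below, or from the
    height above. *)
Lemma card_height_wordsS n d :
  #|height_words n.+1 d| =
  #|height_words n d| + (if d is e.+1 then #|height_words n e| else 0)
  + #|height_words n d.+1|.
Proof.
rewrite /height_words (card_tuple_cons _ (fun w => nonneg w && (size (unmatched w) == d))).
rewrite (bigD1 flat) //= (bigD1 up) //= (bigD1 down) //= big1 ?addn0; last by case=> [[]|].
rewrite addnA; congr (_ + _ + _).
- by congr #|pred_of_set _|; apply/setP=> w; rewrite !inE andbT.
- case: d => [|e]; last by congr #|pred_of_set _|; apply/setP=> w; rewrite !inE andbT eqSS.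
  by apply/eqP; rewrite cards_eq0; apply/eqP/setP=> w; rewrite !inE andbF.
congr #|pred_of_set _|; apply/setP=> w; rewrite !inE -andbA; congr andb.
by case: (unmatched w) => [|t st] //=; rewrite eqSS.
Qed.

Import Order.TTheory Num.Theory.
Local Open Scope ring_scope.

(** * Simple quotients of semisimple modules *)

Lemma simple_sub_act (K : fieldType) (A : Type) (V : vectType K) (act : A -> V -> V)
    (S W : {vspace V}) :
  submodule act S -> simple_module (sub_act act (U := S)) ->
  submodule act W -> (W <= S)%VS -> W = 0%VS \/ W = S.
Proof.
move=> subS [_ simS] subW WS.
pose W' := (linfun (@vsval _ _ S) @^-1: W)%VS.
have memW' u : (u \in W') = (vsval u \in W) by rewrite -memv_preim lfunE.
case: (simS W').
- move=> a u; rewrite !memW' /sub_act => uW.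
  by rewrite vsprojK ?subW // subS // subvsP.
- move=> W0; left; apply/eqP; rewrite -subv0; apply/subvP=> w wW.
  have wS := subvP WS w wW.
  have w0 : vsproj S w = 0 by apply/eqP; rewrite -memv0 -W0 memW' vsprojK.
  by rewrite -(vsprojK wS) w0 linear0 mem0v.
move=> WT; right; apply/eqP; rewrite eqEsubv WS /=; apply/subvP=> w wS.
have : vsproj S w \in W' by rewrite WT memvf.
by rewrite memW' vsprojK.
Qed.

(** Write the algebra as a sum of simple submodules [S i]. As [e] does not kill the
    quotient, it does not kill some [f @: S i], which therefore contains the
    generator [v0] and is everything. The preimage in [S i] of a submodule is 0 or
    [S i], so the submodule is 0 or everything. *)
Lemma simple_quotient_of_semisimple (K : fieldType) (A V : vectType K)
    (mul : A -> A -> A) (act : A -> V -> V) (f : 'Hom(A, V)) (e : A) (v0 x0 : V) :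
  semisimple_module mul ->
  (forall a b, f (mul a b) = act a (f b)) -> limg f = fullv ->
  linear (act e) -> (forall x, exists c, act e x = c *: v0) -> act e x0 != 0 ->
  (forall U, submodule act U -> v0 \in U -> U = fullv) ->
  simple_module act.
Proof.
move=> [m [S [subS simS _ sumS]]] fM f_onto lin_e e_line ex0 gen.
pose act_e := linfun (HB.pack_for {linear V -> V} (act e)
  (GRing.isLinear.Build _ _ _ _ (act e) lin_e)).
have act_eE x : act_e x = act e x by rewrite lfunE.
have [a fa] : exists a, x0 = f a.
  have /memv_imgP[a _ ->] : x0 \in limg f by rewrite f_onto memvf.
  by exists a.
have /memv_sumP[s sS ea] : a \in (\sum_(i < m) S i)%VS by rewrite sumS memvf.
have [i esi] : exists i, act e (f (s i)) != 0.
  apply/existsP; apply: contraNT ex0 => /existsPn h.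
  rewrite fa ea -act_eE !linear_sum big1 // => i _.
  by have := h i; rewrite negbK -act_eE => /eqP.
have v0_in (U : {vspace V}) : submodule act U -> f (s i) \in U -> v0 \in U.
  move=> subU fU; have [c ec] := e_line (f (s i)).
  have : act e (f (s i)) \in U by apply: subU.
  rewrite ec rpredZeq => /orP[/eqP c0|//].
  by rewrite ec c0 scale0r eqxx in esi.
have fS : (f @: S i)%VS = fullv.
  have subf : submodule act (f @: S i)%VS.
    move=> b _ /memv_imgP[u uS ->]; rewrite -fM; apply: memv_img; exact: subS.
  by apply: gen => //; apply: v0_in => //; apply/memv_img/sS.
split.
  apply/eqP=> V0; have : act e x0 \in {:V}%VS by rewrite memvf.
  by rewrite V0 memv0 (negbTE ex0).
move=> U subU; pose W := (S i :&: f @^-1: U)%VS.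
have memW u : (u \in W) = (u \in S i) && (f u \in U).
  by rewrite memv_cap -memv_preim.
have subW : submodule mul W.
  move=> b u; rewrite !memW fM => /andP[uS uU].
  by rewrite subS //= subU.
case: (simple_sub_act (subS i) (simS i) subW (capvSl _ _)) => WE.
  left; apply/eqP; rewrite -subv0; apply/subvP=> u uU.
  have /memv_imgP[t tS ut] : u \in (f @: S i)%VS by rewrite fS memvf.
  have : t \in W by rewrite memW tS -ut.
  by rewrite WE memv0 => /eqP t0; rewrite ut t0 linear0 mem0v.
right; apply: gen => //; apply: v0_in => //.
by have := sS i isT; rewrite -WE memW => /andP[].
Qed.

(** * The action on link states *)

Section Action.
Local Open Scope complex_scope.
Variables (R : realType) (delta : R) (n : nat).
Local Notation C := R[i].
Implicit Types (a b : alg R n) (x : link_space R n) (p q : diagram n).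
Implicit Types (v w : link_state n).

(** Locked, as unfolding leads to the enumeration of all diagrams. *)
Definition diag_vec (p : diagram n) : alg R n := locked [ffun r => (r == p)%:R].

Lemma diag_vecE p q : diag_vec p q = (q == p)%:R.
Proof. by rewrite /diag_vec -lock ffunE. Qed.

Lemma link_space_sum x : x = \sum_v x v *: link_vec R v.
Proof.
apply/ffunP=> u; rewrite sum_ffunE (bigD1 u) //= big1 => [|w wu].
  by rewrite addr0 !ffunE eqxx [_ *: _]mulr1.
by rewrite !ffunE eq_sym (negbTE wu) scaler0.
Qed.

Lemma act_basisE p v w :
  val w = act_link p v ->
  act_basis delta p v = delta%:C ^+ act_loops p v *: link_vec R w.
Proof.
move=> wE; apply/ffunP=> u; rewrite !ffunE -wE val_eqE.
by case: (u == w); rewrite /= ?[_ *: _]mulr1 // [_ *: _]mulr0.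
Qed.

Lemma mul_basisE p q :
  mul_basis delta p q = delta%:C ^+ stack_loops p q *: diag_vec (stack_diagram p q).
Proof.
apply/ffunP=> u; rewrite !ffunE diag_vecE.
have -> : (val u == stack_blocks p q) = (u == stack_diagram p q) by rewrite -val_eqE.
by case: (_ == _); rewrite /= ?[_ *: _]mulr1 // [_ *: _]mulr0.
Qed.

Lemma link_act_linear a : linear (link_act delta a).
Proof.
move=> c x y; rewrite /link_act scaler_sumr -big_split; apply: eq_bigr => p _ /=.
rewrite scaler_sumr -big_split; apply: eq_bigr => v _ /=.
by rewrite scalerA -scalerDl !ffunE; congr (_ *: _); rewrite mulrDr mulrCA.
Qed.

(** The action with the vector fixed and the algebra element variable, so that it can
    be declared linear. *)
Definition act_on x a := link_act delta a x.

Lemma act_on_linear x : linear (act_on x).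
Proof.
move=> c a b; rewrite /act_on /link_act scaler_sumr -big_split; apply: eq_bigr => p _ /=.
rewrite scaler_sumr -big_split; apply: eq_bigr => v _ /=.
by rewrite scalerA -scalerDl !ffunE; congr (_ *: _); rewrite mulrDl mulrA.
Qed.

HB.instance Definition _ a := GRing.isLinear.Build C _ _ _ (link_act delta a) (link_act_linear a).
HB.instance Definition _ x := GRing.isLinear.Build C _ _ _ (act_on x) (act_on_linear x).

Lemma link_actZl c a x : link_act delta (c *: a) x = c *: link_act delta a x.
Proof. exact: (linearZ_LR (act_on x)). Qed.

Lemma link_actZr c a x : link_act delta a (c *: x) = c *: link_act delta a x.
Proof. exact: (linearZ_LR (link_act delta a)). Qed.

Lemma link_act_sum_l (I : finType) (F : I -> alg R n) x :
  link_act delta (\sum_i F i) x = \sum_i link_act delta (F i) x.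
Proof. exact: (linear_sum (act_on x)). Qed.

Lemma link_act_sum_r (I : finType) (F : I -> link_space R n) a :
  link_act delta a (\sum_i F i) = \sum_i link_act delta a (F i).
Proof. exact: (linear_sum (link_act delta a)). Qed.

Lemma link_act_basis p v : link_act delta (diag_vec p) (link_vec R v) = act_basis delta p v.
Proof.
rewrite /link_act (bigD1 p) //= [X in _ + X]big1 => [|q qp]; last first.
  by apply: big1 => u _; rewrite diag_vecE (negbTE qp) mul0r scale0r.
rewrite (bigD1 v) //= diag_vecE ffunE !eqxx mulr1 scale1r addr0 big1 ?addr0 // => u uv.
by rewrite ffunE (negbTE uv) mulr0 scale0r.
Qed.

Lemma alg_sum a : a = \sum_p a p *: diag_vec p.
Proof.
apply/ffunP=> u; rewrite sum_ffunE (bigD1 u) //= big1 => [|w wu].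
  by rewrite addr0 ffunE diag_vecE eqxx [_ *: _]mulr1.
by rewrite ffunE diag_vecE eq_sym (negbTE wu) scaler0.
Qed.

Lemma link_act_expand a x : link_act delta a x = \sum_p a p *: link_act delta (diag_vec p) x.
Proof.
rewrite {1}(alg_sum a) link_act_sum_l.
by apply: eq_bigr => p _; rewrite link_actZl.
Qed.

Lemma link_act_diag_sum p b x :
  link_act delta (diag_vec p) (link_act delta b x) =
  \sum_q b q *: link_act delta (diag_vec p) (link_act delta (diag_vec q) x).
Proof.
rewrite [LHS](congr1 (link_act delta _) (link_act_expand b x)) [LHS]link_act_sum_r.
by apply: eq_bigr => q _; apply: link_actZr.
Qed.

Lemma link_act_mul_diag d p q :
  link_act delta (mul_basis delta p q) (link_vec R (base_state n d)) =
  link_act delta (diag_vec p) (link_act delta (diag_vec q) (link_vec R (base_state n d))).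
Proof.
set v0 := base_state n d; pose r := stack_diagram p q.
have Er := act_basisE (val_top_state d r).
have Eq := act_basisE (val_top_state d q).
have Ep := act_basisE (etrans (val_top_state d r) (act_link_stack d p q)).
have lhs : link_act delta (mul_basis delta p q) (link_vec R v0) =
    delta%:C ^+ stack_loops p q *:
      (delta%:C ^+ act_loops r v0 *: link_vec R (top_state d r)).
  rewrite mul_basisE.
  exact: etrans (link_actZl _ _ _) (congr1 _ (etrans (link_act_basis _ _) Er)).
have rhs : link_act delta (diag_vec p) (link_act delta (diag_vec q) (link_vec R v0)) =
    delta%:C ^+ act_loops q v0 *:
      (delta%:C ^+ act_loops p (top_state d q) *: link_vec R (top_state d r)).
  rewrite [LHS](congr1 (link_act delta _) (etrans (link_act_basis q v0) Eq)).
  exact: etrans (link_actZr _ _ _) (congr1 _ (etrans (link_act_basis _ _) Ep)).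
apply: etrans lhs (etrans _ (esym rhs)); move: (link_vec R _) => u.
by rewrite !scalerA -!exprD act_loops_stack.
Qed.

(** Associativity of the action on the base state, for basis elements from
    [act_link_stack] and [act_loops_stack], in general by bilinearity. *)
Lemma link_act_mul_base d a b :
  link_act delta (alg_mul delta a b) (link_vec R (base_state n d)) =
  link_act delta a (link_act delta b (link_vec R (base_state n d))).
Proof.
move: (link_vec R _) (@link_act_mul_diag d) => v0 mul_diag.
have -> : link_act delta (alg_mul delta a b) v0 =
    \sum_p \sum_q (a p * b q) *: link_act delta (mul_basis delta p q) v0.
  rewrite link_act_sum_l; apply: eq_bigr => p _.
  by rewrite link_act_sum_l; apply: eq_bigr => q _; rewrite link_actZl.
rewrite [RHS]link_act_expand; apply: eq_bigr => p _.
rewrite link_act_diag_sum scaler_sumr; apply: eq_bigr => q _.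
by rewrite mul_diag scalerA.
Qed.

End Action.

(** * The cell modules are simple *)

Lemma quo_act_pi (K : fieldType) (A : Type) (V : vectType K) (act : A -> V -> V)
    (W : {vspace V}) a v :
  submodule act W -> linear (act a) ->
  quo_act act a (vquot_pi W v) = vquot_pi W (act a v).
Proof.
move=> subW lin; apply/eqP; rewrite vquot_piE.
have := subW a _ (vquot_repr_mem W v).
have -> : act a (vquot_repr (vquot_pi W v) - v) = act a (vquot_repr (vquot_pi W v)) - act a v.
  by rewrite addrC -scaleN1r lin scaleN1r addrC.
by [].
Qed.

Lemma card_defects_base n d : (d <= n)%N -> #|defects (base_state n d)| = d.
Proof.
move=> dn; have inj : injective (widen_ord dn) by move=> i j /(congr1 val) /= /val_inj.
rewrite -[RHS](card_ord d) -(card_imset _ inj).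
apply: eq_card => i; rewrite inE; apply/idP/imsetP => [id|[j _ ->]]; last exact: (ltn_ord j).
by exists (Ordinal id) => //; apply: val_inj.
Qed.

Section CellModule.
Local Open Scope complex_scope.
Variables (R : realType) (delta : R) (n d : nat).
Hypotheses (delta_gt0 : (0 < delta)%R) (dn : (d <= n)%N).
Local Notation C := R[i].
Local Notation L := (link_space R n).
Local Notation vec := (@link_vec R n).
Let v0 := base_state n d.

Lemma mem_M k (x : L) : (x \in M R n k) = [forall v, (k < #|defects v|)%N ==> (x v == 0)].
Proof.
apply/idP/forall_inP => [xM v kv|x0]; last first.
  rewrite (link_space_sum x); apply: rpred_sum => v _.
  have [kv|vk] := ltnP k #|defects v|; first by rewrite (eqP (x0 v kv)) scale0r mem0v.
  by apply/rpredZ/memv_span/map_f; rewrite mem_filter vk mem_enum.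
move: xM; rewrite /M; set s := map _ _ => xM.
have {}xM : x \in <<in_tuple s>>%VS by [].
rewrite (coord_span xM) sum_ffunE; apply/eqP/big1 => i _; rewrite ffunE.
have /mapP[u] := mem_nth 0 (ltn_ord i).
rewrite mem_filter => /andP[uk _] /= ->; rewrite ffunE; case: eqP => [vu|_].
  by move: kv; rewrite vu ltnNge uk.
by rewrite scaler0.
Qed.

Lemma vec_M v k : (vec v \in M R n k) = (#|defects v| <= k)%N.
Proof.
rewrite mem_M; apply/forall_inP/idP => [h|vk u ku].
  rewrite leqNgt; apply/negP => /h; rewrite ffunE eqxx.
  by rewrite oner_eq0.
rewrite ffunE; have [uv|_] := eqVneq u v; last by rewrite eqxx.
by move: ku; rewrite uv ltnNge vk.
Qed.

(** Class in the cell module of a vector of [M R n d]; extended linearly to all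
    vectors by [vsproj]. *)
Definition cell (x : L) : V R n d := vquot_pi (M_pred R n d) (vsproj (M R n d) x).

Lemma cell_linear : linear cell.
Proof. by move=> c x y; rewrite /cell !linearP. Qed.
HB.instance Definition _ := GRing.isLinear.Build C L (V R n d) _ cell cell_linear.

Lemma cellZ c x : cell (c *: x) = c *: cell x.
Proof. exact: linearZ. Qed.

Lemma cell_surj y : exists2 x, x \in M R n d & y = cell x.
Proof.
exists (vsval (vquot_repr y)); first exact: subvsP.
by rewrite /cell vsvalK vquot_reprK.
Qed.

Lemma mem_M_pred (u : subvs_of (M R n d)) :
  (u \in M_pred R n d) = if d is e.+1 then vsval u \in M R n e else vsval u == 0.
Proof.
by rewrite -memv_preim lfunE; move: u; case: (d) => [|e] u //=; rewrite memv0.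
Qed.

Lemma cell_eq0 v : (#|defects v| <= d)%N -> (cell (vec v) == 0) = (#|defects v| < d)%N.
Proof.
move=> vd; rewrite -[0](linear0 (vquot_pi (M_pred R n d))) vquot_piE subr0 mem_M_pred.
rewrite vsprojK ?vec_M //; case: (d) => [|e]; last by rewrite vec_M.
apply/negbTE/negP => /eqP/ffunP/(_ v).
by rewrite !ffunE eqxx => /eqP; rewrite oner_eq0.
Qed.

Lemma cell_small v : (#|defects v| < d)%N -> cell (vec v) = 0.
Proof. by move=> vd; apply/eqP; rewrite cell_eq0 // ltnW. Qed.

Lemma sub_act_linear a : linear (sub_act (@link_act R delta n) (U := M R n d) a).
Proof.
by move=> c x y; rewrite /sub_act -linearP -linearP.
Qed.

Lemma M_pred_submodule :
  submodule (sub_act (@link_act R delta n) (U := M R n d)) (M_pred R n d).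
Proof.
move=> a u; rewrite !mem_M_pred /sub_act vsprojK; last first.
  by apply: M_submodule; apply: subvsP.
move: (vsval u) => x; case: (d) => [|k]; last exact: M_submodule.
by move=> /eqP->; rewrite linear0.
Qed.

Lemma V_act_cell a x : x \in M R n d -> V_act delta a (cell x) = cell (link_act delta a x).
Proof.
move=> xM; rewrite /V_act quo_act_pi; last exact: sub_act_linear; last exact: M_pred_submodule.
by rewrite /cell /sub_act vsprojK.
Qed.

Lemma V_act_linear a : linear (V_act delta (n := n) (d := d) a).
Proof.
move=> c y z; have [x xM ->] := cell_surj y; have [t tM ->] := cell_surj z.
by rewrite -linearP !V_act_cell ?rpredD ?rpredZ // !linearP.
Qed.

Let v0d : #|defects v0| = d. Proof. exact: card_defects_base. Qed.

Let v0M : vec v0 \in M R n d. Proof. by rewrite vec_M v0d. Qed.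

Definition orbit_map : 'Hom(alg R n, V R n d) :=
  linfun (cell \o act_on delta (vec v0)).

Lemma orbit_mapE a : orbit_map a = cell (link_act delta a (vec v0)).
Proof. by rewrite lfunE. Qed.

Lemma orbit_map_act a : orbit_map a = V_act delta a (cell (vec v0)).
Proof. by rewrite orbit_mapE V_act_cell. Qed.

Lemma delta_unit k : (delta%:C ^+ k : C) != 0.
Proof. by rewrite expf_neq0 // -(rmorph0 (real_complex R)) (inj_eq (@complexI R)) gt_eqF. Qed.

Lemma thread_act_base v : #|defects v| = d ->
  link_act delta (diag_vec R (thread_diagram v)) (vec v0) =
  delta%:C ^+ act_loops (thread_diagram v) v0 *: vec v.
Proof.
move=> vd; rewrite link_act_basis; apply: act_basisE.
by rewrite -act_link_thread vd.
Qed.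

Lemma cell_thread v : #|defects v| = d -> cell (vec v) \in limg orbit_map.
Proof.
move=> vd; have := memv_img orbit_map (memvf (diag_vec R (thread_diagram v))).
by rewrite orbit_mapE thread_act_base // linearZ rpredZeq (negbTE (delta_unit _)).
Qed.

Lemma limg_orbit_map : limg orbit_map = fullv.
Proof.
apply/eqP; rewrite eqEsubv subvf /=; apply/subvP=> y _.
have [x xM ->] := cell_surj y; rewrite (link_space_sum x) linear_sum.
apply: rpred_sum => v _; rewrite linearZ /=; have [vd|dv|vd] := ltngtP #|defects v| d.
- by rewrite (cell_small vd) scaler0 mem0v.
- by move: xM; rewrite mem_M => /forall_inP/(_ v dv)/eqP->; rewrite scale0r mem0v.
exact/rpredZ/cell_thread.
Qed.

Let e := diag_vec R (thread_diagram v0).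

(** The diagram of the base state has singletons at the upper points from [d] on, and
    these cannot carry a defect. If [d] defects survive, they are the first [d]
    points, and all points are singletons. *)
Lemma act_thread_base_defects (v w : link_state n) : val w = act_link (thread_diagram v0) v ->
  #|defects w| = d -> w = v0.
Proof.
move=> wE wd.
have single (i : 'I_n) : (d <= i)%N -> linked_class (act_edges (thread_diagram v0) v) (inl i) = [set inl i].
  move=> di; have ti : thread v0 (inl i) = inl i.
    rewrite /= inE ltnNge di /=; congr inl; rewrite /lmate.
    exact: (@mate_orbit_blocks _ id (fun _ => erefl)).
  apply/setP=> z; rewrite !inE; apply/idP/eqP => [|->]; last exact: linked0.
  move: z; apply: linked_ind => // B y z /setUP[BP yB zB yi|/imsetP[B' _ ->]].
    move: zB; rewrite (orbit_blocks_mem (threadK v0) BP yB) yi ti setUid.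
    by move/set1P.
  by case/imsetP=> j _ -> _.
have wdef j : j \in defects w -> (j < d)%N.
  rewrite /defects wE inE => /exists_inP[K KK /andP[/eqP uK /exists_inP[k _ kK]]].
  rewrite ltnNge; apply/negP=> dj.
  have jK : inl j \in K by have := set11 j; rewrite -uK inE.
  by move: kK; rewrite (mem_component KK jK) single // inE.
have wD : defects w = [set i : 'I_n | (i < d)%N].
  apply/eqP; rewrite eqEcard; apply/andP; split.
    by apply/subsetP=> j /wdef; rewrite inE.
  by rewrite wd -[X in (_ <= X)%N]v0d.
have fixw i : lmate w i = i.
  have [iw|iw] := boolP (i \in defects w); first exact: lmate_defect.
  have di : (d <= i)%N by move: iw; rewrite wD inE -leqNgt.
  have : [set i] \in blocks w.
    rewrite /blocks wE in_setD1; apply/andP; split; first by apply/set0Pn; exists i; rewrite inE.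
    apply/imsetP; exists [set inl i]; first by rewrite -single // class_component.
    by apply/setP=> j; rewrite !inE.
  rewrite (lmate_blockE w (set11 i)) => /eqP/setP/(_ (lmate w i)).
  by rewrite !inE eqxx orbT => /eqP.
apply: val_inj; rewrite [val w]surjective_pairing; congr pair; last exact: wD.
apply/setP=> B; apply/idP/imsetP => [BP|[i _ ->]].
  have [i iB] : exists i, i \in B.
    by apply/set0Pn; apply: contraTneq BP => ->; have /and3P[] := blocks_partition w.
  exists i => //; apply/eqP; have := BP; rewrite -/(blocks w) (lmate_blockE w iB).
  by rewrite fixw.
by have := lmate_block w i; rewrite fixw.
Qed.

(** The diagram of the base state maps the cell module to a line: the result is the
    base state, or has fewer than [d] defects and vanishes in the quotient. *)
Lemma cell_act_basis v : (#|defects v| <= d)%N ->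
  cell (act_basis delta (thread_diagram v0) v) \in <[cell (vec v0)]>%VS.
Proof.
move=> vd; case: (pickP [pred w : link_state n | val w == act_link (thread_diagram v0) v]).
  move=> w /eqP wE; rewrite (act_basisE delta wE) cellZ; apply: rpredZ.
  have := act_link_defects wE => /leq_trans/(_ vd); rewrite leq_eqVlt => /orP[/eqP wd|wd].
    by rewrite (act_thread_base_defects wE wd) memv_line.
  by rewrite [X in X \in _](cell_small wd) mem0v.
move=> none; suff -> : act_basis delta (thread_diagram v0) v = 0 by rewrite linear0 mem0v.
by apply/ffunP=> w; rewrite !ffunE; have /= -> := none w.
Qed.

Lemma V_act_line y : exists c, V_act delta e y = c *: cell (vec v0).
Proof.
apply/vlineP; have [x xM ->] := cell_surj y; rewrite V_act_cell //.
rewrite (link_space_sum x) (linear_sum (link_act delta e)) linear_sum.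
apply: rpred_sum => v _; rewrite /= (linearZ_LR (link_act delta e)) cellZ.
have [vd|dv] := leqP #|defects v| d; last first.
  by move: xM; rewrite mem_M => /forall_inP/(_ v dv)/eqP->; rewrite scale0r mem0v.
by apply: rpredZ; have := cell_act_basis vd; rewrite -link_act_basis.
Qed.

Lemma V_simple : semisimple_module (@alg_mul R delta n) -> simple_module (@V_act R delta n d).
Proof.
move=> ss.
apply: (@simple_quotient_of_semisimple _ _ _ _ _ orbit_map e (cell (vec v0)) (cell (vec v0)) ss).
- move=> a b; rewrite !orbit_mapE link_act_mul_base V_act_cell //.
  exact: M_submodule.
- exact: limg_orbit_map.
- exact: V_act_linear.
- exact: V_act_line.
- rewrite V_act_cell // thread_act_base // linearZ scaler_eq0 negb_or delta_unit.
  by rewrite cell_eq0 ?v0d // ltnn.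
move=> U subU v0U; apply/eqP; rewrite eqEsubv subvf -limg_orbit_map.
by apply/subvP=> _ /memv_imgP[a _ ->]; rewrite orbit_map_act; apply: subU.
Qed.

End CellModule.

(** * The dimension of the cell modules *)

Section Dimension.
Local Open Scope complex_scope.
Variables (R : realType) (n : nat).
Local Notation C := R[i].
Local Notation vec := (@link_vec R n).

Lemma free_vec (s : seq (link_state n)) : uniq s -> free [seq vec v | v <- s].
Proof.
move=> us; apply/(@freeP _ _ _ (in_tuple [seq vec v | v <- s])) => k k0 i.
have i_s : (i < size s)%N by have := ltn_ord i; rewrite {2}size_map.
have [v0 _] : exists v : link_state n, v \in s.
  have : (0 < size s)%N by apply: leq_ltn_trans i_s.
  by move: (s) => [|v s'] // _; exists v; rewrite mem_head.
move/ffunP/(_ (nth v0 s i)): k0; rewrite sum_ffunE (bigD1 i) //= big1 => [|j ji].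
  rewrite addr0 !ffunE (nth_map v0) // ffunE eqxx => <-.
  by rewrite [_ *: _]mulr1.
have j_s : (j < size s)%N by have := ltn_ord j; rewrite {2}size_map.
rewrite ffunE (nth_map v0) // ffunE nth_uniq // eq_sym.
by have /negbTE := ji; rewrite -val_eqE /= => ->; rewrite scaler0.
Qed.

Lemma dim_M k : \dim (M R n k) = #|[set v : link_state n | (#|defects v| <= k)%N]|.
Proof.
have fr : free [seq vec v | v <- enum (link_state n) & (#|defects v| <= k)%N].
  by apply: free_vec; rewrite filter_uniq ?enum_uniq.
move: fr; rewrite /free => /eqP ->; rewrite size_map size_filter.
by rewrite -sum1_count big_enum_cond -sum1_card; apply: eq_bigl => v; rewrite inE.
Qed.

Lemma dim_M_pred d :
  \dim (M_pred R n d) = #|[set v : link_state n | (#|defects v| < d)%N]|.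
Proof.
case: d => [|e].
  have -> : M_pred R n 0 = 0%VS.
    apply/eqP; rewrite -subv0; apply/subvP=> u.
    by rewrite mem_M_pred memv0 => /eqP u0; apply/eqP/val_inj; rewrite /= u0.
  by rewrite dimv0; apply/esym/eqP; rewrite cards_eq0; apply/eqP/setP=> v; rewrite !inE.
have inj : (M_pred R n e.+1 :&: lker (linfun (@vsval _ _ (M R n e.+1))) = 0)%VS.
  apply/eqP; rewrite -subv0; apply/subvP=> u; rewrite memv_cap memv_ker lfunE => /andP[_ /eqP u0].
  by rewrite memv0; apply/eqP/val_inj.
rewrite -(limg_dim_eq inj) -dim_M; congr (\dim _); apply/eqP; rewrite eqEsubv.
apply/andP; split; apply/subvP=> x.
  by case/memv_imgP=> u; rewrite mem_M_pred => uM ->; rewrite lfunE.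
move=> xM; have xM' : x \in M R n e.+1.
  move: xM; rewrite !mem_M => /forall_inP h; apply/forall_inP => v ev.
  by apply: h; apply: ltnW.
apply/memv_imgP; exists (vsproj (M R n e.+1) x); last by rewrite lfunE /= vsprojK.
by rewrite mem_M_pred vsprojK.
Qed.

Lemma dim_V d :
  \dim {:V R n d} = #|[set v : link_state n | #|defects v| == d]|.
Proof.
rewrite dim_vquot dim_M_pred dimvf -[dim _]/(\dim (M R n d)) dim_M.
rewrite -(cardsID [set v : link_state n | (#|defects v| < d)%N]).
have -> : [set v : link_state n | (#|defects v| <= d)%N] :&: [set v : link_state n | (#|defects v| < d)%N]
   = [set v : link_state n | (#|defects v| < d)%N].
  by apply/setP=> v; rewrite !inE andbC; case: ltnP => // /ltnW->.
rewrite addKn; congr #|pred_of_set _|; apply/setP=> v; rewrite !inE.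
by rewrite -leqNgt eqn_leq andbC.
Qed.

End Dimension.

(** * Motzkin paths and ballot numbers *)

Lemma height_rcons w x : height (rcons w x) = height w + rise x.
Proof. by rewrite /height -cats1 big_cat big_seq1. Qed.

Lemma nonneg_height w : nonneg w -> height (rev w) = (size (unmatched w))%:Z.
Proof.
elim: w => [|x u IH] /=; first by rewrite /height big_nil.
case/andP=> /IH h; rewrite rev_cons height_rcons h; case: x => [[]|] /= ne.
- by rewrite -addn1 PoszD.
- by case: (unmatched u) ne => //= t st _; rewrite -addn1 PoszD addrK.
by rewrite addr0.
Qed.

Lemma nonneg_prefixes w :
  nonneg w <-> (forall k, (k <= size w)%N -> 0 <= height (take k (rev w))).
Proof.
elim: w => [|x u IH] /=; first by split=> // _ [|k] //; rewrite /height big_nil.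
rewrite rev_cons; split=> [/andP[nu ne] k|pos].
  rewrite leq_eqVlt => /orP[/eqP->|ku].
    rewrite take_oversize ?size_rcons ?size_rev // height_rcons (nonneg_height nu).
    by case: x ne => [[]|] //=; case: (unmatched u).
  rewrite -cats1 takel_cat ?size_rev //; apply: (IH.1 nu); exact: ku.
have nu : nonneg u.
  apply/IH => k ku; have := pos k (leqW ku).
  by rewrite -cats1 takel_cat ?size_rev.
rewrite nu; have := pos _ (leqnn _); rewrite take_oversize ?size_rcons ?size_rev //.
rewrite height_rcons (nonneg_height nu); case: x {pos} => [[]|] //=.
by case: (unmatched u).
Qed.

Lemma motzkin_height_words n : motzkin n = #|height_words n 0|.
Proof.
have rev_inj : injective (fun w : n.-tuple (option bool) => [tuple of rev w]).
  by move=> w w' [] /(can_inj revK) /val_inj.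
rewrite /motzkin -(card_imset _ rev_inj); congr #|pred_of_set _|; apply/setP=> w.
have mem_w : (w \in height_words n 0) =
    [forall k : 'I_n.+1, 0 <= height (take k (rev w))] && (height (rev w) == 0).
  rewrite inE; apply/andP/andP => [[nw uw]|[/forallP pos hw]].
    split; last by rewrite nonneg_height // (eqP uw).
    apply/forallP=> k; apply: (nonneg_prefixes _).1 => //.
    by rewrite size_tuple -ltnS.
  have nw : nonneg w.
    apply/nonneg_prefixes => k; rewrite size_tuple -ltnS => kn.
    exact: (pos (Ordinal kn)).
  by split=> //; move: hw; rewrite nonneg_height.
rewrite mem_w; apply/imsetP/idP => [[w' + ->]|h].
  by rewrite inE /= revK.
exists [tuple of rev w]; first by rewrite inE.
by apply: val_inj; rewrite /= revK.
Qed.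

(** Pascal's rule; both sides vanish when [a] is odd. *)
Lemma bin_halfS N a : bin_half N.+1 a.+2 = (bin_half N a.+2 + bin_half N a)%N.
Proof. by rewrite /bin_half /= negbK; case: (odd a) => //=; rewrite binS. Qed.

(** By the reflection principle, the number of paths with [N] steps up or down from
    height 0 to height [d] that stay nonnegative. *)
Definition ballot (N d : nat) : int :=
  (bin_half N (N + d))%:Z - (bin_half N (N + d + 2))%:Z.

(** The boundary case of the reflection: the two central coefficients are equal. *)
Lemma bin_half_central N : bin_half N.+1 N.+1 = (bin_half N N.+1).*2.
Proof.
rewrite /bin_half; case: ifP => // /negbT h; have oN : odd N by move: h; rewrite /= negbK.
have -> : N.+1./2 = (N./2).+1 by rewrite -uphalfE uphalf_half oN.
rewrite binS -addnn; congr addn; rewrite -[in RHS]bin_sub; last by lia.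
by congr binomial; lia.
Qed.

Lemma ballotS N d :
  ballot N.+1 d = (if d is e.+1 then ballot N e else 0) + ballot N d.+1.
Proof.
case: d => [|e]; rewrite /ballot.
  rewrite add0r addn0 bin_half_central !addn2 addn1 bin_halfS.
  rewrite -addnn !PoszD; ring.
rewrite !addn2 !addSnnS !addnS !bin_halfS !PoszD; ring.
Qed.

Lemma m_ndE n d : m_nd n d = \sum_(0 <= k < n.+1) 'C(n, k)%:Z * ballot (n - k) d.
Proof. by []. Qed.

Lemma m_nd0 d : m_nd 0 d = (d == 0%N)%:Z.
Proof.
rewrite m_ndE big_nat1 bin0 mul1r /ballot /bin_half subnn add0n.
case: d => [|d]; first by [].
rewrite /= addn2 /= negbK; case: ifP => // od; rewrite ?subrr // !bin0n /=.
by have -> : (uphalf d == 0%N) = false by lia.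
Qed.

(** Pascal's rule on the number of flat steps, and the recursion of the ballot numbers
    on the others. *)
Lemma m_ndS n d :
  m_nd n.+1 d = m_nd n d + (if d is e.+1 then m_nd n e else 0) + m_nd n d.+1.
Proof.
rewrite !m_ndE big_nat_recl //= bin0 mul1r subn0.
under eq_bigr => k _ do rewrite binS PoszD mulrDl subSS.
rewrite big_split /= [LHS]addrA [LHS]addrC -[RHS]addrA; congr (_ + _).
have -> : ballot n.+1 d + \sum_(0 <= k < n.+1) 'C(n, k.+1)%:Z * ballot (n - k) d =
    \sum_(0 <= k < n.+1) 'C(n, k)%:Z * ballot (n - k).+1 d.
  transitivity (\sum_(0 <= k < n.+2) 'C(n, k)%:Z * ballot (n.+1 - k) d).
    by rewrite [RHS]big_nat_recl //= bin0 mul1r subn0; under [in RHS]eq_bigr do rewrite subSS.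
  rewrite big_nat_recr //= bin_small // mul0r addr0 !big_mkord.
  by apply: eq_bigr => k _; rewrite subSn // -ltnS.
under [LHS]eq_bigr => k _ do rewrite ballotS mulrDr.
rewrite big_split; congr (_ + _); case: d => [|e] //.
by apply: big1 => k _; rewrite mulr0.
Qed.

Lemma card_height_words n d : (#|height_words n d|)%:Z = m_nd n d.
Proof.
elim: n d => [|n IH] d; first by rewrite card_height_words0 m_nd0.
by rewrite card_height_wordsS m_ndS !PoszD !IH; case: d => [|e]; rewrite ?IH.
Qed.

Theorem corollary4p8 (R : realType) (delta : R) (n d : nat)
    (hdelta : generic delta) (hd : (d <= n)%N) :
  [/\ simple_module (@V_act R delta n d),
      (\dim {:V R n d})%:Z = m_nd n d
    & \dim {:V R n 0} = motzkin n].
Proof.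
have [delta_gt0 semisimple] := hdelta.
split; first exact: V_simple.
  by rewrite dim_V card_link_states card_height_words.
by rewrite dim_V card_link_states motzkin_height_words.
Qed.
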